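(* Let $S_\omega$ and $S_{\omega'}$ be standard graded skew polynomial algebras in $n$ variables at cube roots of unity, with $n\le5$. Then $\mathrm{GrMod}\,S_\omega$ is equivalent to $\mathrm{GrMod}\,S_{\omega'}$ if and only if the point simplicial complexes $\Delta_\omega$ and $\Delta_{\omega'}$ are isomorphic.
   Context: Let $k$ be an algebraically closed field of characteristic $0$. For $\omega=(\omega_{ij})\in M_n(k)$ with $\omega_{ii}=1$, $\omega_{ij}\omega_{ji}=1$ and every $\omega_{ij}$ a cube root of unity, $S_\omega=k\langle x_1,\dots,x_n\rangle/(x_ix_j-\omega_{ij}x_jx_i)$ with $\deg x_i=1$. $\mathrm{GrMod}\,S$ is the category of $\mathbb{Z}$-graded right $S$-modules with degree-preserving homomorphisms. The point simplicial complex $\Delta_\omega$ is the simplicial complex on $[n]$ whose faces are the subsets $F\subset[n]$ with $\omega_{ij}\omega_{jh}\omega_{hi}=1$ for all distinct $i,j,h\in F$. Two simplicial complexes are isomorphic if there is a bijection of vertex sets inducing a bijection of their sets of facets. *)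

(* Defs.v *)
From HB Require Import structures.
From mathcomp Require Import all_boot all_order all_fingroup all_algebra.
Set Implicit Arguments. Unset Strict Implicit. Unset Printing Implicit Defensive.
Import Order.TTheory GRing.Theory Num.Theory.
Local Open Scope ring_scope.

Definition klinear (k : fieldType) (U V : lmodType k) (f : U -> V) : Prop :=
  forall (a : k) (u v : U), f (a *: u + v) = a *: f u + f v.

Definition cube_skew (k : fieldType) (n : nat) (w : 'M[k]_n) : Prop :=
  [/\ forall i, w i i = 1,
      forall i j, w i j * w j i = 1 &
      forall i j, w i j ^+ 3 = 1].

(* GrMod S_w.  S_w = k<x_1..x_n>/(x_i x_j - w_ij x_j x_i), deg x_i = 1.
   A Z-graded right S_w-module is a family of k-vector spaces M_d (d : int)
   together with k-linear maps  (. x_i) : M_d -> M_(d+1)  satisfying the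
   defining relations  (m x_i) x_j = w_ij (m x_j) x_i.                   *)
Record grmod (k : fieldType) (n : nat) (w : 'M[k]_n) := GrMod {
  gm_sp : int -> lmodType k;
  gm_act : forall (d : int) (i : 'I_n), gm_sp d -> gm_sp (d + 1);
  gm_lin : forall d i, klinear (@gm_act d i);
  gm_rel : forall d (i j : 'I_n) (m : gm_sp d),
    @gm_act (d + 1) j (@gm_act d i m) = w i j *: @gm_act (d + 1) i (@gm_act d j m)
}.

Arguments gm_sp {k n w} _ _.
Arguments gm_act {k n w} _ _ _ _.

Record grhom (k : fieldType) (n : nat) (w : 'M[k]_n) (M N : grmod w) := GrHom {
  gh_fun : forall d, gm_sp M d -> gm_sp N d;
  gh_lin : forall d, klinear (@gh_fun d);
  gh_comm : forall d i (m : gm_sp M d),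
    @gh_fun (d + 1) (gm_act M d i m) = gm_act N d i (@gh_fun d m)
}.

Arguments gh_fun {k n w M N} _ _ _.

Definition hom_eq (k : fieldType) (n : nat) (w : 'M[k]_n) (M N : grmod w)
  (f g : grhom M N) : Prop := forall d m, gh_fun f d m = gh_fun g d m.

Section HomOps.
Variables (k : fieldType) (n : nat) (w : 'M[k]_n).

Lemma hid_lin (M : grmod w) d : klinear (fun m : gm_sp M d => m).
Proof. by []. Qed.
Lemma hid_comm (M : grmod w) d i (m : gm_sp M d) :
  (fun _ x => x) (d + 1) (gm_act M d i m) = gm_act M d i ((fun _ x => x) d m).
Proof. by []. Qed.
Definition hid (M : grmod w) : grhom M M :=
  @GrHom k n w M M (fun _ x => x) (@hid_lin M) (@hid_comm M).

Lemma hcomp_lin (M N P : grmod w) (g : grhom N P) (f : grhom M N) d :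
  klinear (fun m => gh_fun g d (gh_fun f d m)).
Proof. by move=> a u v; rewrite (gh_lin f) (gh_lin g). Qed.
Lemma hcomp_comm (M N P : grmod w) (g : grhom N P) (f : grhom M N) d i
  (m : gm_sp M d) :
  (fun d m => gh_fun g d (gh_fun f d m)) (d + 1) (gm_act M d i m) =
  gm_act P d i ((fun d m => gh_fun g d (gh_fun f d m)) d m).
Proof. by rewrite /= (gh_comm f) (gh_comm g). Qed.
Definition hcomp (M N P : grmod w) (g : grhom N P) (f : grhom M N) : grhom M P :=
  GrHom (@hcomp_lin M N P g f) (@hcomp_comm M N P g f).
End HomOps.

Record functor (k : fieldType) (n n' : nat) (w : 'M[k]_n) (w' : 'M[k]_n') := Functor {
  F_obj : grmod w -> grmod w';
  F_hom : forall M N : grmod w, grhom M N -> grhom (F_obj M) (F_obj N);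
  F_resp : forall (M N : grmod w) (f g : grhom M N),
    hom_eq f g -> hom_eq (F_hom f) (F_hom g);
  F_id : forall M : grmod w, hom_eq (F_hom (hid M)) (hid (F_obj M));
  F_comp : forall (M N P : grmod w) (g : grhom N P) (f : grhom M N),
    hom_eq (F_hom (hcomp g f)) (hcomp (F_hom g) (F_hom f))
}.

Section FunctorOps.
Variables (k : fieldType).

Definition fid (n : nat) (w : 'M[k]_n) : functor w w :=
  @Functor k n n w w id (fun M N f => f)
    (fun M N f g e => e) (fun M d m => erefl) (fun M N P g f d m => erefl).

Lemma fcomp_resp n1 n2 n3 (w1 : 'M[k]_n1) (w2 : 'M[k]_n2) (w3 : 'M[k]_n3)
  (G : functor w2 w3) (F : functor w1 w2) (M N : grmod w1) (f g : grhom M N) :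
  hom_eq f g -> hom_eq (F_hom G (F_hom F f)) (F_hom G (F_hom F g)).
Proof. by move=> e; apply: F_resp; apply: F_resp. Qed.

Lemma fcomp_id n1 n2 n3 (w1 : 'M[k]_n1) (w2 : 'M[k]_n2) (w3 : 'M[k]_n3)
  (G : functor w2 w3) (F : functor w1 w2) (M : grmod w1) :
  hom_eq (F_hom G (F_hom F (hid M))) (hid (F_obj G (F_obj F M))).
Proof.
move=> d m; rewrite (F_resp (@F_id _ _ _ _ _ F M)); exact: F_id.
Qed.

Lemma fcomp_comp n1 n2 n3 (w1 : 'M[k]_n1) (w2 : 'M[k]_n2) (w3 : 'M[k]_n3)
  (G : functor w2 w3) (F : functor w1 w2) (M N P : grmod w1)
  (g : grhom N P) (f : grhom M N) :
  hom_eq (F_hom G (F_hom F (hcomp g f)))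
         (hcomp (F_hom G (F_hom F g)) (F_hom G (F_hom F f))).
Proof.
move=> d m; rewrite (F_resp (@F_comp _ _ _ _ _ F _ _ _ g f)); exact: F_comp.
Qed.

Definition fcomp n1 n2 n3 (w1 : 'M[k]_n1) (w2 : 'M[k]_n2) (w3 : 'M[k]_n3)
  (G : functor w2 w3) (F : functor w1 w2) : functor w1 w3 :=
  @Functor k n1 n3 w1 w3 (fun M => F_obj G (F_obj F M))
    (fun M N f => F_hom G (F_hom F f))
    (@fcomp_resp _ _ _ _ _ _ G F) (@fcomp_id _ _ _ _ _ _ G F)
    (@fcomp_comp _ _ _ _ _ _ G F).
End FunctorOps.

Record natiso (k : fieldType) (n n' : nat) (w : 'M[k]_n) (w' : 'M[k]_n')
  (F G : functor w w') := NatIso {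
  ni_fwd : forall M, grhom (F_obj F M) (F_obj G M);
  ni_bwd : forall M, grhom (F_obj G M) (F_obj F M);
  ni_bf : forall M, hom_eq (hcomp (ni_bwd M) (ni_fwd M)) (hid _);
  ni_fb : forall M, hom_eq (hcomp (ni_fwd M) (ni_bwd M)) (hid _);
  ni_nat : forall (M N : grmod w) (f : grhom M N),
    hom_eq (hcomp (F_hom G f) (ni_fwd M)) (hcomp (ni_fwd N) (F_hom F f))
}.

Definition grmod_equiv (k : fieldType) (n n' : nat) (w : 'M[k]_n) (w' : 'M[k]_n')
  : Prop :=
  exists (F : functor w w') (G : functor w' w),
    inhabited (natiso (fcomp G F) (fid w)) /\ inhabited (natiso (fcomp F G) (fid w')).

Definition pface (k : fieldType) (n : nat) (w : 'M[k]_n) (F : {set 'I_n}) : bool :=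
  [forall i in F, forall j in F, forall h in F,
     [&& i != j, j != h & i != h] ==> (w i j * w j h * w h i == 1)].

Definition pfacet (k : fieldType) (n : nat) (w : 'M[k]_n) (F : {set 'I_n}) : bool :=
  pface w F && [forall G : {set 'I_n}, (pface w G && (F \subset G)) ==> (G == F)].

Definition sc_iso (k : fieldType) (n : nat) (w w' : 'M[k]_n) : Prop :=
  exists s : {perm 'I_n}, forall F : {set 'I_n}, pfacet w F = pfacet w' (s @: F).

(* Main.v *)
(** Both directions go through the cube roots of unity
    c(i,j,h) = w_ij w_jh w_hi: the faces are the sets on which c is 1.

    If an equivalence F is given, F maps simple modules to simple modules and
    hence the free modules P_d, as their projective covers, to free modules
    P'_(d+c) with a uniform shift c.  Since F preserves sums of morphisms,
    the spaces Hom(P_(d+1), P_d) = S_1 are matched by invertible matrices, up to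
    what F does to scalars.  A module with one-dimensional components on which
    x_i acts by p_i and then by q_i is a solution of p_i q_j = w_ij p_j q_i;
    such a q exists exactly when the support of p is a face.  F therefore gives an
    invertible matrix A carrying natural-number points of the scheme of w to
    points of the scheme of w'.  A nonzero term of det A is a permutation s with
    A_(s i, i) <> 0 for all i, and for p generic on a face f the support of A p
    contains s(f), so s maps faces to faces; the same holds for the inverse
    equivalence, so by counting s is an isomorphism of complexes.

    Conversely, isomorphic complexes have the same triples with c = 1 up to
    relabelling.  For n <= 5 a finite check shows that then c and c' agree up to a
    permutation, so w' is obtained from w by relabelling and a coboundary, and
    the corresponding Zhang twist is an equivalence. *)

Require Import Defs.
From HB Require Import structures.
From mathcomp Require Import all_boot all_order all_fingroup all_algebra.
From mathcomp Require Import ring zify.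
From Stdlib Require Import FunctionalExtensionality ProofIrrelevance Classical.
Set Implicit Arguments. Unset Strict Implicit. Unset Printing Implicit Defensive.
Import Order.TTheory GRing.Theory Num.Theory.
Local Open Scope ring_scope.

(** * The finite check *)

Definition tc (k : fieldType) (n : nat) (w : 'M[k]_n) (i j h : 'I_n) : k :=
  w i j * w j h * w h i.

Section Certificates.
Local Open Scope nat_scope.

Fixpoint words3 (m : nat) : seq (seq nat) :=
  if m is m'.+1 then [seq x :: s | x <- [:: 0; 1; 2], s <- words3 m'] else [:: [::]].

(* The exponents a_ij (0 < i < j < 5) of an alternating matrix with vanishing
   row 0 are stored as the list a_12, a_13, a_23, a_14, a_24, a_34. *)
Definition pair_idx (i j : nat) : nat := (j.-1 * j.-2)./2 + i.-1.

(** Exponents count modulo 3, so doubling an entry stands for negating it. *)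
Definition expo (l : seq nat) (i j : nat) : nat :=
  if (i == 0) || (j == 0) then 0
  else if i < j then nth 0 l (pair_idx i j)
  else if j < i then (nth 0 l (pair_idx j i)).*2
  else 0.

Definition texpo (l : seq nat) (i j h : nat) : nat :=
  (expo l i j + expo l j h + expo l h i) %% 3.

Definition triples (n : nat) : seq (nat * (nat * nat)) :=
  [seq x <- [seq (i, p) | i <- iota 0 n, p <- [seq (j, h) | j <- iota 0 n, h <- iota 0 n]]
     | x.1 < x.2.1 < x.2.2].

(** The bits record which triangles lie in the complex; they are the key of the tables. *)
Definition zeros (n : nat) (l : seq nat) : seq bool :=
  [seq texpo l x.1 x.2.1 x.2.2 == 0 | x <- triples n].

Fixpoint lookup (z : seq bool) (s : seq (seq bool * seq nat)) : seq nat :=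
  if s is (z', l) :: s' then if z == z' then l else lookup z s' else [::].

(** Comparing the triples through 0 is enough, because they determine all others, as in
    [tc_basepoint]. *)
Definition matches (n : nat) (l r t : seq nat) : bool :=
  all (fun x => texpo l (nth 0 t x.1) (nth 0 t x.2.1) (nth 0 t x.2.2)
                == texpo r x.1 x.2.1 x.2.2)
      [seq x <- triples n | x.1 == 0].

Definition good (n : nat) (reps : seq (seq bool * seq nat)) (l t : seq nat) : bool :=
  [&& perm_eq t (iota 0 n) & matches n l (lookup (zeros n l) reps) t].

Fixpoint nub_reps (s : seq (seq bool * seq nat)) : seq (seq bool * seq nat) :=
  if s is x :: s' then x :: [seq y <- nub_reps s' | y.1 != x.1] else [::].

(* The tables are stored in normal form: the search for permutations is done
   once, and the kernel only verifies its result in cert_tab_good. *)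
Definition reps_tab : seq (seq (seq bool * seq nat)) := Eval vm_compute in
  [seq nub_reps [seq (zeros n l, l) | l <- words3 6] | n <- iota 0 6].

Fixpoint first_match (n : nat) (l r : seq nat) (ts : seq (seq nat)) : seq nat :=
  if ts is t :: ts' then if matches n l r t then t else first_match n l r ts' else [::].

Definition cert_tab : seq (seq (seq nat)) := Eval vm_compute in
  [seq [seq first_match n l (lookup (zeros n l) (nth [::] reps_tab n))
          (permutations (iota 0 n)) | l <- words3 6] | n <- iota 0 6].

Lemma cert_tab_good :
  all (fun n => all2 (good n (nth [::] reps_tab n)) (words3 6) (nth [::] cert_tab n))
      (iota 0 6).
Proof. by vm_compute. Qed.

Lemma triples_lt n x : x \in triples n -> [&& (x.1 < n), (x.2.1 < n) & (x.2.2 < n)].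
Proof.
rewrite mem_filter => /andP[_ /allpairsP[[i p] /= [hi]]].
case/allpairsP=> [[j h] /= [hj hh] ->] ->; move: hi hj hh.
by rewrite !mem_iota !add0n /= => -> -> ->.
Qed.

Lemma mem_triples n i j h : (i < j) -> (j < h) -> (h < n) -> (i, (j, h)) \in triples n.
Proof.
move=> ij jh hn; rewrite mem_filter /= ij jh /=.
have jn := ltn_trans jh hn.
by apply/allpairs_f; [|apply/allpairs_f]; rewrite mem_iota ?add0n ?(ltn_trans ij).
Qed.

End Certificates.

(** * Triple products and faces *)

Section TripleProducts.
Variables (k : fieldType) (n : nat) (w : 'M[k]_n).
Hypothesis hw : cube_skew w.

Lemma cube_skew_neq0 i j : w i j != 0.
Proof.
case: hw => _ hV _; apply/eqP => w0.
by move/eqP: (hV i j); rewrite w0 mul0r eq_sym oner_eq0.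
Qed.

(** The boundary of a tetrahedron: every edge at [o] occurs once in each direction and cancels. *)
Lemma tc_basepoint o i j h : tc w i j h = tc w o i j * tc w o j h * tc w o h i.
Proof.
case: hw => _ hV _; rewrite /tc.
have -> : w o i * w i j * w j o * (w o j * w j h * w h o) * (w o h * w h i * w i o)
  = w i j * w j h * w h i * ((w o i * w i o) * (w o j * w j o) * (w o h * w h o)).
  by ring.
by rewrite !hV !mulr1.
Qed.

Lemma tc_oii o i : tc w o i i = 1.
Proof. by case: hw => h1 hV _; rewrite /tc h1 mulr1 hV. Qed.

Lemma tc_ooi o i : tc w o o i = 1.
Proof. by case: hw => h1 hV _; rewrite /tc h1 mul1r hV. Qed.

Lemma tc_oio o i : tc w o i o = 1.
Proof. by case: hw => h1 hV _; rewrite /tc h1 mulr1 hV. Qed.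

Lemma tc_swap o i j : tc w o i j * tc w o j i = 1.
Proof.
case: hw => _ hV _; rewrite /tc.
have -> : w o i * w i j * w j o * (w o j * w j i * w i o)
  = (w o i * w i o) * (w i j * w j i) * (w o j * w j o) by ring.
by rewrite !hV !mulr1.
Qed.

Lemma tc_cube i j h : tc w i j h ^+ 3 = 1.
Proof. by case: hw => _ _ h3; rewrite /tc !exprMn !h3 !mulr1. Qed.

(** Triples with a repeated index always have product 1, so all triples of the face may be
    quantified over. *)
Lemma pfaceP (F : {set 'I_n}) :
  reflect {in F & &, forall i j h, tc w i j h = 1} (pface w F).
Proof.
apply: (iffP idP) => [/forall_inP hF i j h Fi Fj Fh | hF].
  have [<-|nij] := eqVneq i j; first exact: tc_ooi.
  have [<-|njh] := eqVneq j h; first exact: tc_oii.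
  have [<-|nih] := eqVneq i h; first exact: tc_oio.
  have /forall_inP/(_ _ Fj)/forall_inP/(_ _ Fh) := hF _ Fi.
  by rewrite nij njh nih => /eqP.
apply/forall_inP => i Fi; apply/forall_inP => j Fj; apply/forall_inP => h Fh.
by apply/implyP => _; apply/eqP; apply: hF.
Qed.

(** Passes from facets, in which [sc_iso] is stated, to faces: faces are closed under subsets, and
    each extends to a maximal one. *)
Lemma pface_facetE (F : {set 'I_n}) :
  pface w F = [exists G : {set 'I_n}, pfacet w G && (F \subset G)].
Proof.
apply/idP/existsP => [fF | [G /andP[/andP[/pfaceP fG _] /subsetP sFG]]]; last first.
  by apply/pfaceP => i j h /sFG ? /sFG ? /sFG ?; apply: fG.
have [G /maxsetP[fG maxG] sFG] := maxset_exists (P := pface w) fF.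
exists G; rewrite sFG andbT /pfacet fG /=; apply/forallP => H.
by apply/implyP => /andP[fH sGH]; rewrite (maxG _ fH sGH).
Qed.
End TripleProducts.

(** * Normal form of the triple products *)

Section NormalForm.
Variables (k : fieldType) (z : k).
Hypotheses (z_root : z ^+ 2 + z + 1 = 0) (z_neq1 : z != 1).

Lemma zeta_cube : z ^+ 3 = 1.
Proof.
apply/eqP; rewrite -subr_eq0.
have -> : z ^+ 3 - 1 = (z - 1) * (z ^+ 2 + z + 1) by ring.
by rewrite z_root mulr0.
Qed.

Lemma zeta_expr_mod e : z ^+ (e %% 3) = z ^+ e.
Proof. by rewrite [in RHS](divn_eq e 3) exprD mulnC exprM zeta_cube expr1n mul1r. Qed.

Lemma zeta_expr_eq1 e : (e < 3)%N -> (z ^+ e == 1) = (e == 0%N).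
Proof.
case: e => [|[|[|//]]] _; first by rewrite expr0 eqxx.
  by rewrite expr1 (negbTE z_neq1).
apply/negbTE/eqP => z2; move: zeta_cube; rewrite exprS z2 mulr1 => z1.
by move/eqP: z_neq1.
Qed.

Definition zlog (x : k) : nat := if x == 1 then 0 else if x == z then 1 else 2.

Lemma zlog_in x : zlog x \in [:: 0; 1; 2]%N.
Proof. by rewrite /zlog; case: ifP => // _; case: ifP. Qed.

Lemma zlogK x : x ^+ 3 = 1 -> z ^+ zlog x = x.
Proof.
move=> x3; rewrite /zlog; case: eqP => [->|/eqP x1]; first by rewrite expr0.
case: eqP => [->|/eqP xz]; first by rewrite expr1.
have /eqP : (x - 1) * (x - z) * (x - z ^+ 2) = 0.
  have -> : (x - 1) * (x - z) * (x - z ^+ 2)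
    = (x ^+ 3 - 1) + (z ^+ 2 + z + 1) * (x - x ^+ 2) + (z ^+ 3 - 1) * (x - 1) by ring.
  by rewrite x3 zeta_cube z_root !subrr !mul0r !addr0.
by rewrite !mulf_eq0 !subr_eq0 (negbTE x1) (negbTE xz) /= => /eqP.
Qed.

Variables (m : nat) (w : 'M[k]_m.+1).
Hypotheses (hm : (m < 5)%N) (hw : cube_skew w).

(** Indices beyond [m] are sent to [ord0] by [inord]; the entries they produce belong to no pair of
    indices in range. *)
Definition expo_list : seq nat :=
  let f i j := zlog (tc w ord0 (inord i) (inord j)) in
  [:: f 1 2; f 1 3; f 2 3; f 1 4; f 2 4; f 3 4].

Lemma expo_list_words : expo_list \in words3 6.
Proof.
rewrite /expo_list; do 6!(apply: (allpairs_f cons); first exact: zlog_in).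
by rewrite inE.
Qed.

Lemma nth_expo_list (i j : 'I_m.+1) : (0 < i)%N -> (i < j)%N ->
  nth 0%N expo_list (pair_idx i j) = zlog (tc w ord0 i j).
Proof.
move=> i0 ij; rewrite -[in RHS](inord_val i) -[in RHS](inord_val j).
have : (j < 5)%N by apply: leq_trans (ltn_ord j) _.
move: i0 ij; case: (i : nat) => [//|[|[|[|i']]]] _;
  by case: (j : nat) => [//|[//|[//|[//|[//|//]]]]].
Qed.

Lemma tc0_expo (i j : 'I_m.+1) : tc w ord0 i j = z ^+ expo expo_list i j.
Proof.
rewrite /expo; case: eqP => [i0|/eqP i0] /=.
  by have -> : i = ord0 by [apply: val_inj]; rewrite tc_ooi.
case: eqP => [j0|/eqP j0] /=.
  by have -> : j = ord0 by [apply: val_inj]; rewrite tc_oio.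
rewrite -!lt0n in i0 j0; case: (ltngtP i j) => [ij|ji|/val_inj->]; last by rewrite tc_oii.
  by rewrite nth_expo_list // zlogK // tc_cube.
rewrite nth_expo_list // -muln2 exprM zlogK ?tc_cube //.
(* The inverse of a cube root of unity is its square. *)
rewrite -[LHS]mulr1 -(tc_cube hw ord0 j i) exprS mulrA.
by rewrite tc_swap // mul1r.
Qed.

Lemma tc_texpo (i j h : 'I_m.+1) : tc w i j h = z ^+ texpo expo_list i j h.
Proof. by rewrite (tc_basepoint hw ord0) !tc0_expo -!exprD zeta_expr_mod. Qed.

Lemma tc_eq1 (i j h : 'I_m.+1) : (tc w i j h == 1) = (texpo expo_list i j h == 0%N).
Proof. by rewrite tc_texpo zeta_expr_eq1 // ltn_mod. Qed.

(** The right side sees [w] only through [zeros], that is through its complex, so matrices with the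
    same complex share a normal form. *)
Lemma normal_form : exists t : {perm 'I_m.+1}, forall i j h,
  tc w (t i) (t j) (t h) =
  z ^+ texpo (lookup (zeros m.+1 expo_list) (nth [::] reps_tab m.+1)) i j h.
Proof.
set r := lookup _ _.
have [t] : exists t, perm_eq t (iota 0 m.+1) && matches m.+1 expo_list r t.
  have /allP/(_ m.+1) := cert_tab_good.
  rewrite mem_iota add0n => /(_ hm); rewrite all2E => /andP[/eqP sz /allP H].
  have lt_i : (index expo_list (words3 6) < size (words3 6))%N.
    by rewrite index_mem expo_list_words.
  exists (nth [::] (nth [::] cert_tab m.+1) (index expo_list (words3 6))).
  have /H : (expo_list, nth [::] (nth [::] cert_tab m.+1) (index expo_list (words3 6)))
      \in zip (words3 6) (nth [::] cert_tab m.+1).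
    rewrite -{1}(nth_index [::] expo_list_words) -nth_zip //.
    by rewrite mem_nth // size_zip -sz minnn.
  by [].
case/andP=> pt /allP mt.
have st : size t = m.+1 by rewrite (perm_size pt) size_iota.
have lt_t (i : 'I_m.+1) : (nth 0 t i < m.+1)%N.
  have := mem_nth 0%N (_ : (i < size t)%N); rewrite st (perm_mem pt) mem_iota add0n => H.
  exact: H.
have inj : injective (fun i : 'I_m.+1 => Ordinal (lt_t i)).
  move=> i j [] /eqP; rewrite nth_uniq ?st // => [/eqP/val_inj //|].
  by rewrite (perm_uniq pt) iota_uniq.
exists (perm inj); have tE i : perm inj i = nth 0%N t i :> nat by rewrite permE.
pose w' : 'M[k]_m.+1 := \matrix_(i, j) w (perm inj i) (perm inj j).
have hw' : cube_skew w' by case: hw => h1 h2 h3; split=> *; rewrite !mxE.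
have tcE i j h : tc w (perm inj i) (perm inj j) (perm inj h) = tc w' i j h.
  by rewrite /tc !mxE.
(* The table gives the pairs i < j; alternation then gives all pairs, and the base point 0 all
   triples. *)
have lt0 (i j : 'I_m.+1) : (0 < i)%N -> (i < j)%N ->
    tc w' ord0 i j = z ^+ expo r i j.
  move=> i0 ij; have /mt : (0%N, (i : nat, j : nat)) \in [seq x <- triples m.+1 | x.1 == 0%N].
    by rewrite mem_filter mem_triples.
  rewrite -tcE tc_texpo !tE => /eqP /= ->.
  by rewrite /texpo /= {1 3}/expo /= orbT add0n addn0 zeta_expr_mod.
have all0 (i j : 'I_m.+1) : tc w' ord0 i j = z ^+ expo r i j.
  case: (posnP i) => [i0|i0].
    by have -> : i = ord0 by [apply: val_inj]; rewrite tc_ooi.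
  case: (posnP j) => [j0|j0].
    by have -> : j = ord0 by [apply: val_inj]; rewrite tc_oio // /expo orbT.
  case: (ltngtP i j) => [ij|ji|/val_inj->]; first exact: lt0.
    rewrite -[LHS]mulr1 -(tc_cube hw' ord0 j i) exprS mulrA.
    rewrite tc_swap // mul1r lt0 // -exprM muln2 /expo.
    by rewrite !(gtn_eqF i0) !(gtn_eqF j0) /= (ltnNge i j) (ltnW ji) /= ji.
  by rewrite tc_oii // /expo ltnn if_same.
move=> i j h; rewrite tcE (tc_basepoint hw' ord0) !all0 -!exprD.
by rewrite zeta_expr_mod.
Qed.

End NormalForm.

(** * Zhang twists *)

Section Linear.
Variables (k : fieldType) (U V : lmodType k) (f : U -> V).
Hypothesis hf : klinear f.

Lemma klinD u v : f (u + v) = f u + f v.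
Proof. by have := hf 1 u v; rewrite !scale1r. Qed.

Lemma klin0 : f 0 = 0.
Proof. by apply: (addIr (f 0)); rewrite -klinD !add0r. Qed.

Lemma klinZ a u : f (a *: u) = a *: f u.
Proof. by have := hf a u 0; rewrite klin0 !addr0. Qed.

Lemma klin_sum (I : Type) (r : seq I) (P : pred I) (F : I -> U) :
  f (\sum_(i <- r | P i) F i) = \sum_(i <- r | P i) f (F i).
Proof. exact: (big_morph f klinD klin0). Qed.
End Linear.

Section Twist.
Variables (k : fieldType) (n : nat) (w w' : 'M[k]_n).
Variables (t : 'I_n -> 'I_n) (mu : int -> 'I_n -> k).
Hypothesis h_mu : forall d i j,
  mu d i * mu (d + 1) j * w (t i) (t j) = w' i j * (mu d j * mu (d + 1) i).

(** [h_mu] is the condition under which this relabelled and rescaled action satisfies the relations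
    of [w']. *)
Definition twist_act (M : grmod w) d i (m : gm_sp M d) : gm_sp M (d + 1) :=
  mu d i *: gm_act M d (t i) m.

Lemma twist_lin (M : grmod w) d i : klinear (@twist_act M d i).
Proof. by move=> a u v; rewrite /twist_act gm_lin scalerDr !scalerA mulrC. Qed.

Lemma twist_rel (M : grmod w) d (i j : 'I_n) (m : gm_sp M d) :
  twist_act j (twist_act i m) = w' i j *: twist_act i (twist_act j m).
Proof.
rewrite /twist_act !(klinZ (@gm_lin _ _ _ M _ _)) (gm_rel (t i) (t j)) !scalerA.
by rewrite (mulrC (mu (d + 1) j)) h_mu (mulrC (mu d j)) mulrA.
Qed.

Definition twist_mod (M : grmod w) : grmod w' :=
  GrMod (@twist_lin M) (@twist_rel M).

Lemma twist_comm (M N : grmod w) (f : grhom M N) d i (m : gm_sp (twist_mod M) d) :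
  gh_fun f (d + 1) (gm_act (twist_mod M) d i m) =
  gm_act (twist_mod N) d i (gh_fun f d m).
Proof. by rewrite /= /twist_act (klinZ (gh_lin f (d := d + 1))) gh_comm. Qed.

Definition twist_hom (M N : grmod w) (f : grhom M N) :
  grhom (twist_mod M) (twist_mod N) :=
  @GrHom k n w' (twist_mod M) (twist_mod N) (gh_fun f) (@gh_lin _ _ _ _ _ f)
    (twist_comm f).

Definition twist : functor w w' :=
  @Functor k n n w w' twist_mod twist_hom (fun M N f g e => e)
    (fun M d m => erefl) (fun M N P g f d m => erefl).
End Twist.

Section TwistInverse.
Variables (k : fieldType) (n : nat) (w w' : 'M[k]_n).
Variables (t t' : 'I_n -> 'I_n) (mu mu' : int -> 'I_n -> k).
Hypothesis h_mu : forall d i j,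
  mu d i * mu (d + 1) j * w (t i) (t j) = w' i j * (mu d j * mu (d + 1) i).
Hypothesis h_mu' : forall d i j,
  mu' d i * mu' (d + 1) j * w' (t' i) (t' j) = w i j * (mu' d j * mu' (d + 1) i).
Hypothesis tK : cancel t' t.
Hypothesis muK : forall d i, mu' d i * mu d (t' i) = 1.

Lemma twistK_act (M : grmod w) d i (m : gm_sp M d) :
  gm_act (twist_mod h_mu' (twist_mod h_mu M)) d i m = gm_act M d i m.
Proof. by rewrite /= /twist_act /= /twist_act scalerA muK scale1r tK. Qed.

Let fwd (M : grmod w) : grhom (twist_mod h_mu' (twist_mod h_mu M)) M :=
  @GrHom k n w (twist_mod h_mu' (twist_mod h_mu M)) M (fun _ m => m)
    (fun d => @hid_lin k n w M d) (@twistK_act M).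
Let bwd (M : grmod w) : grhom M (twist_mod h_mu' (twist_mod h_mu M)) :=
  @GrHom k n w M (twist_mod h_mu' (twist_mod h_mu M)) (fun _ m => m)
    (fun d => @hid_lin k n w M d) (fun d i m => esym (@twistK_act M d i m)).

Lemma twistK : inhabited (natiso (fcomp (twist h_mu') (twist h_mu)) (fid w)).
Proof.
by constructor; exists fwd bwd.
Qed.
End TwistInverse.

Section Sufficiency.
Variables (k : fieldType) (n : nat) (w w' : 'M[k]_n).
Hypotheses (hw : cube_skew w) (hw' : cube_skew w').

(** Taking the powers [mu i ^ d] as scalars in degree d reduces the twist condition in all degrees
    to a single one. *)
Lemma skew_twist_equiv (t : {perm 'I_n}) (mu : 'I_n -> k) :
  (forall i, mu i != 0) ->
  (forall i j, mu j * w (t i) (t j) = w' i j * mu i) -> grmod_equiv w w'.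
Proof.
move=> mu0 hmu.
have h1 d i j : mu i ^ d * mu j ^ (d + 1) * w (t i) (t j)
              = w' i j * (mu j ^ d * mu i ^ (d + 1)).
  rewrite !expfzDr // !expr1z; move: (mu i ^ d) (mu j ^ d) => x y.
  have -> : x * (y * mu j) * w (t i) (t j)
    = x * y * (mu j * w (t i) (t j)) by ring.
  by rewrite hmu; ring.
(* The inverse twist: inverse permutation, and inverse scalars read at the permuted index. *)
pose t' := (t^-1)%g; pose mu' i := (mu (t' i))^-1.
have mu'0 i : mu' i != 0 by rewrite invr_neq0.
have h2 d i j : mu' i ^ d * mu' j ^ (d + 1) * w' (t' i) (t' j)
              = w i j * (mu' j ^ d * mu' i ^ (d + 1)).
  rewrite !expfzDr //.
  have := hmu (t' i) (t' j); rewrite !permKV !expr1z /mu'.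
  move: (mu0 (t' i)) (mu0 (t' j)); move: (mu (t' i)) (mu (t' j)) => a b a0 b0 e.
  have -> : w i j = b^-1 * (w' (t' i) (t' j) * a) by rewrite -e mulKf.
  move: (a^-1 ^ d) (b^-1 ^ d) => x y.
  by field; rewrite a0 b0.
have muK d i : mu' i ^ d * mu (t' i) ^ d = 1.
  by rewrite -exprzMl ?unitfE // mulVf // exp1rz.
exists (twist h1), (twist h2); split; apply: twistK => //.
- exact: permKV.
- exact: permK.
by move=> d i; rewrite -[i in mu i](permK t) mulrC muK.
Qed.

(** Equal triple products mean that the two matrices differ by a coboundary, which a twist
    removes. *)
Lemma tc_perm_equiv (t : {perm 'I_n}) :
  (forall i j h, tc w (t i) (t j) (t h) = tc w' i j h) -> grmod_equiv w w'.
Proof.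
move=> H; case: (pickP (fun _ : 'I_n => true)) => [o _|n0]; last first.
  by apply: (@skew_twist_equiv 1%g (fun=> 1)) => i; have := n0 i.
(* The coboundary is read off at the base point [o], as the quotient of [w' o i] by
   [w (t o) (t i)]. *)
apply: (@skew_twist_equiv t (fun i => w (t i) (t o) * w' o i)) => [i|i j].
  by rewrite mulf_neq0 ?cube_skew_neq0.
apply: (mulIf (cube_skew_neq0 hw (t o) (t i))).
have := H o i j; rewrite /tc; case: hw hw' => _ hV _ [_ hV' _] e.
have -> : w (t j) (t o) * w' o j * w (t i) (t j) * w (t o) (t i)
   = w (t o) (t i) * w (t i) (t j) * w (t j) (t o) * w' o j by ring.
rewrite e -!mulrA hV' mulr1.
have -> : w' i j * (w (t i) (t o) * (w' o i * w (t o) (t i)))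
   = w' o i * w' i j * (w (t i) (t o) * w (t o) (t i)) by ring.
by rewrite hV mulr1.
Qed.
End Sufficiency.

(** * From isomorphic complexes to equivalent categories *)

Section Combinatorics.
Variables (k : closedFieldType) (n : nat) (w w' : 'M[k]_n).
Hypotheses (hchar : [pchar k] =i pred0) (hn : (n <= 5)%N).
Hypotheses (hw : cube_skew w) (hw' : cube_skew w').

Lemma exists_zeta : exists2 z : k, z ^+ 2 + z + 1 = 0 & z != 1.
Proof.
have sp : size ('X^2 + 'X + 1 : {poly k}) = 3.
  by rewrite -addrA size_polyDl ?size_polyXn // -polyC1 size_XaddC.
have [z] : exists z, root ('X^2 + 'X + 1 : {poly k}) z.
  by apply/closed_rootP; rewrite sp.
rewrite rootE !hornerE => /eqP z0; exists z => //.
(* At 1 the polynomial has the value 3, which is nonzero in characteristic 0. *)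
apply: contraPneq z0 => ->; rewrite expr1n => /eqP.
by rewrite -(natrD _ 1 1) natr1 (proj1 (pcharf0P k) hchar).
Qed.

Lemma sc_iso_pface (s : {perm 'I_n}) :
  (forall F : {set 'I_n}, pfacet w F = pfacet w' (s @: F)) ->
  forall F : {set 'I_n}, pface w F = pface w' (s @: F).
Proof.
move=> hs F; rewrite pface_facetE // [RHS]pface_facetE //.
apply/existsP/existsP => -[G /andP[fG sFG]].
  by exists (s @: G); rewrite -hs fG imsetS.
have GE : s @: (s @^-1: G) = G by rewrite -preim_permV; apply/setP => x; rewrite !inE permKV.
exists (s @^-1: G); rewrite hs GE fG /=.
by apply/subsetP => x xF; rewrite inE (subsetP sFG) // imset_f.
Qed.

Lemma face_iso_tc (s : {perm 'I_n}) :
  (forall F : {set 'I_n}, pface w F = pface w' (s @: F)) ->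
  forall i j h, (tc w i j h == 1) = (tc w' (s i) (s j) (s h) == 1).
Proof.
move=> hs i j h.
(* A triple product is invariant under rotation and inverted by a swap, so whether it is 1 depends
   only on the set of its indices. *)
have tcE (v : 'M[k]_n) a b c : cube_skew v -> (tc v a b c == 1) = pface v [set a; b; c].
  move=> hv; apply/eqP/(pfaceP hv) => [e|]; last by apply; rewrite !inE eqxx ?orbT.
  have e' : tc v a c b = 1 by rewrite -[LHS]mul1r -[X in X * _]e tc_swap.
  have r1 x y t : tc v x y t = tc v y t x by rewrite /tc; ring.
  move=> x y t; rewrite !inE -!orbA.
  move=> /or3P[]/eqP-> /or3P[]/eqP-> /or3P[]/eqP->;
    rewrite ?tc_ooi ?tc_oii ?tc_oio //; by [rewrite r1 ?e ?e' | rewrite -r1 ?e ?e'].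
rewrite !tcE // hs; congr (pface w' _).
by apply/setP => x; rewrite !imsetU !imset_set1.
Qed.

End Combinatorics.

Lemma sc_iso_equiv (k : closedFieldType) (hchar : [pchar k] =i pred0)
    (n : nat) (hn : (n <= 5)%N) (w w' : 'M[k]_n)
    (hw : cube_skew w) (hw' : cube_skew w') :
  sc_iso w w' -> grmod_equiv w w'.
Proof.
case: n hn w w' hw hw' => [|m] hm w w' hw hw' [s /(sc_iso_pface hw hw')/(face_iso_tc hw hw') hs].
  by apply: (tc_perm_equiv hw hw' (t := 1%g)) => -[].
have [z z0 z1] := exists_zeta hchar.
(* Relabelling [w'] along [s] gives a matrix with the same triangles as [w] on the same vertices. *)
pose v : 'M[k]_m.+1 := \matrix_(i, j) w' (s i) (s j).
have hv : cube_skew v by case: hw' => h1 h2 h3; split=> *; rewrite !mxE.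
have [t tE] := normal_form z0 hm hw.
have [t' tE'] := normal_form z0 hm hv.
(* Equal keys select the same representative in the table. *)
have zE : zeros m.+1 (expo_list z v) = zeros m.+1 (expo_list z w).
  apply/eq_in_map => x /triples_lt/and3P[h1 h2 h3].
  rewrite -(tc_eq1 z0 z1 hm hw (Ordinal h1) (Ordinal h2) (Ordinal h3)).
  rewrite -(tc_eq1 z0 z1 hm hv (Ordinal h1) (Ordinal h2) (Ordinal h3)).
  by rewrite hs /tc !mxE.
apply: (tc_perm_equiv hw hw' (t := (s^-1 * (t'^-1 * t))%g)) => i j h.
by rewrite !permM tE -zE -tE' !permKV /tc !mxE !permKV.
Qed.

(** * The category of graded modules *)

Section Homs.
Variables (k : fieldType) (n : nat) (w : 'M[k]_n).
Implicit Types M N P Q : grmod w.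

Lemma hom_ext M N (f g : grhom M N) : hom_eq f g -> f = g.
Proof.
case: f g => [f fl fc] [g gl gc] /= e.
have fg : f = g.
  by apply: functional_extensionality_dep => d; apply: functional_extensionality => m; apply: e.
by subst g; congr GrHom; apply: proof_irrelevance.
Qed.

Lemma hom_app M N (f g : grhom M N) d m : f = g -> gh_fun f d m = gh_fun g d m.
Proof. by move=> ->. Qed.

Lemma hcompE M N P (g : grhom N P) (f : grhom M N) d m :
  gh_fun (hcomp g f) d m = gh_fun g d (gh_fun f d m).
Proof. by []. Qed.

Lemma hcompA M N P Q (h : grhom P Q) (g : grhom N P) (f : grhom M N) :
  hcomp h (hcomp g f) = hcomp (hcomp h g) f.
Proof. exact: hom_ext. Qed.

Lemma hcomp1f M N (f : grhom M N) : hcomp (hid N) f = f.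
Proof. exact: hom_ext. Qed.

Lemma hcompf1 M N (f : grhom M N) : hcomp f (hid M) = f.
Proof. exact: hom_ext. Qed.

Lemma hom0 M N (f : grhom M N) d : gh_fun f d 0 = 0.
Proof. exact: klin0 (gh_lin f (d := d)). Qed.

Lemma homZ M N (f : grhom M N) d a m : gh_fun f d (a *: m) = a *: gh_fun f d m.
Proof. exact: klinZ (gh_lin f (d := d)) a m. Qed.

Lemma act0 M d i : gm_act M d i 0 = 0.
Proof. exact: klin0 (@gm_lin _ _ _ M d i). Qed.

Lemma actZ M d i a m : gm_act M d i (a *: m) = a *: gm_act M d i m.
Proof. exact: klinZ (@gm_lin _ _ _ M d i) a m. Qed.

Lemma hzero_lin M N d : klinear (fun _ : gm_sp M d => 0 : gm_sp N d).
Proof. by move=> a u v; rewrite scaler0 addr0. Qed.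
Lemma hzero_comm M N d i (m : gm_sp M d) : (0 : gm_sp N (d + 1)) = gm_act N d i 0.
Proof. by rewrite act0. Qed.
Definition hzero M N : grhom M N := GrHom (@hzero_lin M N) (@hzero_comm M N).

Lemma hadd_lin M N (f g : grhom M N) d :
  klinear (fun m : gm_sp M d => gh_fun f d m + gh_fun g d m).
Proof. by move=> a u v; rewrite (gh_lin f) (gh_lin g) scalerDr addrACA. Qed.
Lemma hadd_comm M N (f g : grhom M N) d i (m : gm_sp M d) :
  gh_fun f _ (gm_act M d i m) + gh_fun g _ (gm_act M d i m) =
  gm_act N d i (gh_fun f d m + gh_fun g d m).
Proof. by rewrite !gh_comm (klinD (@gm_lin _ _ _ N d i)). Qed.
Definition hadd M N (f g : grhom M N) : grhom M N :=
  GrHom (@hadd_lin M N f g) (@hadd_comm M N f g).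

Lemma hscale_lin M N c (f : grhom M N) d : klinear (fun m : gm_sp M d => c *: gh_fun f d m).
Proof. by move=> a u v; rewrite (gh_lin f) scalerDr !scalerA mulrC. Qed.
Lemma hscale_comm M N c (f : grhom M N) d i (m : gm_sp M d) :
  c *: gh_fun f _ (gm_act M d i m) = gm_act N d i (c *: gh_fun f d m).
Proof. by rewrite gh_comm actZ. Qed.
Definition hscale M N c (f : grhom M N) : grhom M N :=
  GrHom (@hscale_lin M N c f) (@hscale_comm M N c f).

Lemma hscaleE M N c (f : grhom M N) d m : gh_fun (hscale c f) d m = c *: gh_fun f d m.
Proof. by []. Qed.

Lemma hom_neq0 M N (f : grhom M N) : f <> hzero M N -> exists d m, gh_fun f d m != 0.
Proof.
move=> nz; apply: NNPP => H; apply: nz; apply: hom_ext => d m /=.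
by apply/eqP/negP => /negP fm; apply: H; exists d, m.
Qed.

Definition hiso M N := exists (a : grhom M N) (b : grhom N M),
  hcomp b a = hid M /\ hcomp a b = hid N.

Lemma hiso_sym M N : hiso M N -> hiso N M.
Proof. by case=> a [b [? ?]]; exists b, a. Qed.

Lemma hiso_trans M N P : hiso M N -> hiso N P -> hiso M P.
Proof.
move=> [a [b [ba ab]]] [c [d [dc cd]]]; exists (hcomp c a), (hcomp b d); split.
  by rewrite -hcompA (hcompA d) dc hcomp1f.
by rewrite -hcompA (hcompA a) ab hcomp1f.
Qed.

Section DirectSum.
Variables M N : grmod w.
Definition dsum_sp d : lmodType k := (gm_sp M d * gm_sp N d)%type.
Definition dsum_act d i (m : dsum_sp d) : dsum_sp (d + 1) :=
  (gm_act M d i m.1, gm_act N d i m.2).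
Lemma dsum_lin d i : klinear (@dsum_act d i).
Proof. by move=> a u v; rewrite /dsum_act /= !gm_lin. Qed.
Lemma dsum_rel d (i j : 'I_n) (m : dsum_sp d) :
  dsum_act j (dsum_act i m) = w i j *: dsum_act i (dsum_act j m).
Proof. by rewrite /dsum_act /= gm_rel (gm_rel i j m.2). Qed.
Definition dsum : grmod w := GrMod dsum_lin dsum_rel.

Lemma dfst_lin d : klinear (fun m : gm_sp dsum d => m.1). Proof. by []. Qed.
Definition dfst : grhom dsum M :=
  @GrHom k n w dsum M (fun _ m => m.1) dfst_lin (fun _ _ _ => erefl).
Lemma dsnd_lin d : klinear (fun m : gm_sp dsum d => m.2). Proof. by []. Qed.
Definition dsnd : grhom dsum N :=
  @GrHom k n w dsum N (fun _ m => m.2) dsnd_lin (fun _ _ _ => erefl).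

Variables (X : grmod w) (f : grhom X M) (g : grhom X N).
Lemma hpair_lin d : klinear (fun m : gm_sp X d => (gh_fun f d m, gh_fun g d m) : dsum_sp d).
Proof. by move=> a u v; rewrite (gh_lin f) (gh_lin g). Qed.
Lemma hpair_comm d i (m : gm_sp X d) :
  (gh_fun f _ (gm_act X d i m), gh_fun g _ (gm_act X d i m)) =
  dsum_act i ((gh_fun f d m, gh_fun g d m) : dsum_sp d).
Proof. by rewrite !gh_comm. Qed.
Definition hpair : grhom X dsum := @GrHom k n w X dsum _ hpair_lin hpair_comm.
End DirectSum.

(* The subquotient of M carried by the degrees in D; it is a submodule when D
   is closed upwards and a quotient when D is closed downwards. *)
Section Restriction.
Variables (M : grmod w) (D : int -> bool).
Definition res_sp d : lmodType k := if D d then gm_sp M d else ('rV[k]_0 : lmodType k).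

Definition sel (b : bool) (A Z : lmodType k) (x : A) : (if b then A else Z) :=
  match b return (if b then A else Z) with true => x | false => 0 end.
Definition unsel (b : bool) (A Z : lmodType k) : (if b then A else Z) -> A :=
  match b return (if b then A else Z) -> A with true => fun x => x | false => fun=> 0 end.

Lemma sel_lin b A Z : klinear (U := A) (V := if b then A else Z) (@sel b A Z).
Proof. by case: b => // a u v /=; rewrite scaler0 addr0. Qed.
Lemma unsel_lin b A Z : klinear (U := if b then A else Z) (V := A) (@unsel b A Z).
Proof. by case: b => // a u v /=; rewrite scaler0 addr0. Qed.
Lemma selK b A Z x : @unsel b A Z (sel b Z x) = if b then x else 0.
Proof. by case: b. Qed.

Definition res_in d (m : gm_sp M d) : res_sp d := sel (D d) _ m.
Definition res_out d (m : res_sp d) : gm_sp M d := unsel m.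
Definition res_act d i (m : res_sp d) : res_sp (d + 1) := res_in (gm_act M d i (res_out m)).

Lemma res_outK d m : res_out (@res_in d m) = if D d then m else 0.
Proof. exact: selK. Qed.
Lemma res_in_eq0 d m : D d = false -> @res_in d m = 0.
Proof. by rewrite /res_in /res_sp => ->. Qed.
Lemma res_out_eq0 d m : D d = false -> @res_out d m = 0.
Proof. by move: m; rewrite /res_out /res_sp => m Dd; move: m; rewrite Dd. Qed.
Lemma res_in_lin d : klinear (@res_in d). Proof. exact: sel_lin. Qed.
Lemma res_out_lin d : klinear (@res_out d). Proof. exact: unsel_lin. Qed.

Lemma res_lin d i : klinear (@res_act d i).
Proof. by move=> a u v; rewrite /res_act res_out_lin gm_lin res_in_lin. Qed.
Lemma res_rel d (i j : 'I_n) (m : res_sp d) :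
  res_act j (res_act i m) = w i j *: res_act i (res_act j m).
Proof.
rewrite /res_act !res_outK; case: (D (d + 1)); last by rewrite !act0 (klin0 (@res_in_lin _)) scaler0.
by rewrite gm_rel (klinZ (@res_in_lin _)).
Qed.
Definition res : grmod w := GrMod res_lin res_rel.

Lemma to_res_comm (Ddown : forall d, D (d + 1) -> D d) d i (m : gm_sp M d) :
  res_in (gm_act M d i m) = res_act i (res_in m).
Proof.
rewrite /res_act res_outK; have [D1|/negbTE D1] := boolP (D (d + 1)); first by rewrite Ddown.
by rewrite !res_in_eq0.
Qed.
Definition to_res (Ddown : forall d, D (d + 1) -> D d) : grhom M res :=
  @GrHom k n w M res _ res_in_lin (to_res_comm Ddown).

Lemma of_res_comm (Dup : forall d, D d -> D (d + 1)) d i (m : res_sp d) :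
  res_out (res_act i m) = gm_act M d i (res_out m).
Proof.
rewrite /res_act res_outK; case: ifP => // D1; rewrite res_out_eq0 ?act0 //.
by apply/negbTE/negP => /Dup; rewrite D1.
Qed.
Definition of_res (Dup : forall d, D d -> D (d + 1)) : grhom res M :=
  @GrHom k n w res M _ res_out_lin (of_res_comm Dup).
End Restriction.

End Homs.

(** * Simple modules and free modules *)

Section Cast.
Variables (k : fieldType) (n : nat) (w : 'M[k]_n) (M : grmod w).

(* Reads an element of degree e as one of degree d; it is 0 unless e = d. *)
Definition dcast (e d : int) (m : gm_sp M e) : gm_sp M d :=
  match e =P d with
  | ReflectT E => eq_rect e (gm_sp M) m d E
  | ReflectF _ => 0
  end.

Lemma dcast_id d (m : gm_sp M d) : dcast d m = m :> gm_sp M d.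
Proof. by rewrite /dcast; case: eqP => // E; rewrite (eq_irrelevance E erefl). Qed.

Lemma dcast_trans e e' d (m : gm_sp M e) : e = e' -> dcast d (dcast e' m) = dcast d m.
Proof. by move=> E; subst e'; rewrite dcast_id. Qed.

Lemma act_dcast e d i (m : gm_sp M e) : e = d -> gm_act M d i (dcast d m) = dcast (d + 1) (gm_act M e i m).
Proof. by move=> E; subst d; rewrite !dcast_id. Qed.

Lemma dcastZ e d a (m : gm_sp M e) : dcast d (a *: m) = a *: dcast d m :> gm_sp M d.
Proof.
rewrite /dcast; case: (e =P d) => [E|_]; last by rewrite scaler0.
by subst d.
Qed.
End Cast.

Section Simple.
Variables (k : fieldType) (n : nat) (w : 'M[k]_n) (d : int).

(** The truth value of [e == d] is used as a dimension, 1 or 0; [kk] is the simple module k in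
    degree d. *)
Definition kk_sp (e : int) : lmodType k := 'rV[k]_(e == d).
Definition kk_act (e : int) (i : 'I_n) (v : kk_sp e) : kk_sp (e + 1) := 0.
Lemma kk_lin e i : klinear (@kk_act e i).
Proof. by move=> a u v; rewrite /kk_act scaler0 addr0. Qed.
Lemma kk_rel e (i j : 'I_n) (v : kk_sp e) : kk_act j (kk_act i v) = w i j *: kk_act i (kk_act j v).
Proof. by rewrite /kk_act scaler0. Qed.
Definition kk : grmod w := GrMod kk_lin kk_rel.

Definition kk1 : gm_sp kk d := const_mx 1.

Lemma kk1_neq0 : kk1 != 0.
Proof.
rewrite /kk1; apply/eqP; rewrite /= /kk_sp eqxx => /rowP/(_ ord0).
by rewrite !mxE => /eqP; rewrite oner_eq0.
Qed.

Lemma kk_span (v : gm_sp kk d) : exists a, v = a *: kk1.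
Proof.
move: v; rewrite /kk1 /= /kk_sp eqxx => v; exists (v 0 0).
by apply/rowP => j; rewrite !mxE mulr1 ord1.
Qed.

Lemma kk_off e (v : gm_sp kk e) : e <> d -> v = 0.
Proof.
move=> /eqP/negbTE ed; move: v; rewrite /= /kk_sp ed => v.
by apply/rowP => -[].
Qed.

Section Out.
Variables (M : grmod w) (m : gm_sp M d).
Hypothesis m_soc : forall i, gm_act M d i m = 0.

(** The sum of coordinates is the single entry in degree d and an empty sum elsewhere. *)
Definition kk_map_fun e (v : kk_sp e) : gm_sp M e := (\sum_j v 0 j) *: dcast e m.
Lemma kk_map_lin e : klinear (@kk_map_fun e).
Proof.
move=> a u v; rewrite /kk_map_fun scalerA -scalerDl; congr (_ *: _).
by rewrite mulr_sumr -big_split; apply: eq_bigr => j _; rewrite !mxE.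
Qed.
Lemma kk_map_comm e i (v : kk_sp e) :
  kk_map_fun (kk_act i v) = gm_act M e i (kk_map_fun v).
Proof.
rewrite /kk_act (klin0 (@kk_map_lin _)) /kk_map_fun actZ.
case: (d =P e) => [E|/eqP/negbTE E]; first by subst e; rewrite dcast_id m_soc scaler0.
rewrite big1 ?scale0r // => j _.
have jl : (0 < (e == d))%N := leq_ltn_trans (leq0n j) (ltn_ord j).
by rewrite eq_sym E in jl.
Qed.
Definition kk_map : grhom kk M := @GrHom k n w kk M _ kk_map_lin kk_map_comm.
Lemma kk_map1 : gh_fun kk_map d kk1 = m.
Proof.
rewrite /= /kk_map_fun dcast_id; under eq_bigr do rewrite mxE.
by rewrite sumr_const card_ord eqxx scale1r.
Qed.
End Out.

Lemma kk_ext (M : grmod w) (f g : grhom kk M) :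
  gh_fun f d kk1 = gh_fun g d kk1 -> f = g.
Proof.
move=> e; apply: hom_ext => d' v; case: (d' =P d) => [E|E].
  by subst d'; have [a ->] := kk_span v; rewrite !homZ e.
by rewrite (kk_off v E) !hom0.
Qed.
End Simple.

Section FreeModule.
Variables (k : fieldType) (n : nat) (w : 'M[k]_n).
Hypothesis hw : cube_skew w.

(* A word is read from right to left: i :: s stands for m |-> (m x_s) x_i. *)
Fixpoint wdeg (d : int) (s : seq 'I_n) : int :=
  if s is _ :: s' then wdeg d s' + 1 else d.

Lemma wdegE d s : wdeg d s = d + (size s)%:Z.
Proof. elim: s => [|i s IH] /=; lia. Qed.

Definition word_sorted (s : seq 'I_n) : bool := sorted (fun i j : 'I_n => j <= i)%N s.

(** The sorted form of [i :: s]: the new letter moves past the larger ones, and [wcoef] collects the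
    factors that the relations produce. *)
Fixpoint wins (i : 'I_n) (s : seq 'I_n) : seq 'I_n :=
  if s is j :: s' then if (j <= i)%N then i :: s else j :: wins i s' else [:: i].

Fixpoint wcoef (i : 'I_n) (s : seq 'I_n) : k :=
  if s is j :: s' then if (j <= i)%N then 1 else w j i * wcoef i s' else 1.

Lemma wdeg_wins d i s : wdeg d (wins i s) = wdeg d s + 1.
Proof. by elim: s => //= j s IH; case: ifP => //= _; rewrite IH. Qed.

Lemma wins_sorted i s : word_sorted s -> word_sorted (wins i s).
Proof.
rewrite /word_sorted; elim: s => //= j s IH; case: leqP => [ji|ij] /= ps.
  by rewrite ji.
case: s ps IH => [|l s] /= ps IH; first by rewrite (ltnW ij).
case/andP: ps => lj ps; move: (IH ps); case: ifP => /= _ ->.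
  by rewrite (ltnW ij).
by rewrite lj.
Qed.

Lemma wins_head i s : word_sorted (i :: s) -> wins i s = i :: s /\ wcoef i s = 1.
Proof. by case: s => //= j s /andP[-> _]. Qed.

(** With [wcoef_comm] this gives the defining relations on the sorted words, which makes their span
    a module. *)
Lemma wins_comm i j s : wins j (wins i s) = wins i (wins j s).
Proof.
elim: s => [|l s IH] /=.
  by case: (ltngtP i j) => // /val_inj ->.
have [li|il] := leqP l i; have [lj|jl] := leqP l j => /=.
- case: (ltngtP i j) => [ij|ji|/val_inj -> //]; rewrite ?(li, lj) //=.
- by rewrite leqNgt (leq_trans jl li) /= li leqNgt jl.
- by rewrite lj leqNgt (leq_trans il lj) /= leqNgt il.
by rewrite (leqNgt l i) il (leqNgt l j) jl /= IH.
Qed.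

Lemma wcoef_comm i j s :
  wcoef i s * wcoef j (wins i s) = w i j * (wcoef j s * wcoef i (wins j s)).
Proof.
have [w1 wV _] := hw.
elim: s => [|l s IH] /=.
  case: (ltngtP i j) => [ij|ji|/val_inj ->]; rewrite ?w1 ?(mulr1, mul1r) ?wV //.
have [li|il] := leqP l i; have [lj|jl] := leqP l j => /=.
- case: (ltngtP i j) => [ij|ji|/val_inj ->]; rewrite ?(li, lj) ?w1 ?(mulr1, mul1r) ?wV //.
- by rewrite leqNgt (leq_trans jl li) /= li leqNgt jl /=; ring.
- rewrite lj leqNgt (leq_trans il lj) /= leqNgt il /= mulr1 mul1r mulrA.
  by rewrite mulrA wV mul1r.
rewrite (leqNgt l i) il (leqNgt l j) jl /=.
have -> : w l i * wcoef i s * (w l j * wcoef j (wins i s))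
  = w l i * w l j * (wcoef i s * wcoef j (wins i s)) by ring.
by rewrite IH; ring.
Qed.

Section Word.
Variable d : int.

(** The fixed length keeps the type finite. For f < d the absolute value still yields a length, and
    the degree condition then leaves no word. *)
Definition word (f : int) : finType :=
  {t : (`|f - d|%N).-tuple 'I_n | word_sorted t && (wdeg d t == f)}.
Definition wval f (t : word f) : seq 'I_n := tval (val t).

Lemma wval_inj f : injective (@wval f).
Proof. by move=> s t /val_inj/val_inj. Qed.
Lemma wval_sorted f (t : word f) : word_sorted (wval t).
Proof. by case/andP: (valP t). Qed.
Lemma wval_deg f (t : word f) : wdeg d (wval t) = f.
Proof. by case/andP: (valP t) => _ /eqP. Qed.

Lemma word_of f s : word_sorted s -> wdeg d s = f -> exists t : word f, wval t = s.
Proof.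
move=> ss ds; have sz : size s == `|f - d|%N by rewrite -ds wdegE; apply/eqP; lia.
have H : word_sorted (Tuple sz) && (wdeg d (Tuple sz) == f) by rewrite /= ss ds eqxx.
by exists (Sub (Tuple sz) H); rewrite /wval SubK.
Qed.

(** Used from right to left, to expand a value at one word into a sum over all words. *)
Lemma sum_word (V : nmodType) f s (H : seq 'I_n -> V) :
  word_sorted s -> wdeg d s = f ->
  \sum_(t : word f) (H (wval t) *+ (wval t == s)) = H s.
Proof.
move=> ss ds; have [t tE] := word_of ss ds.
rewrite (bigD1 t) //= tE eqxx big1 ?addr0 // => u.
by rewrite -tE (inj_eq (@wval_inj f)) => /negbTE ->.
Qed.

Definition fm_sp (f : int) : lmodType k := {ffun word f -> k^o}.
Definition fm_act f (i : 'I_n) (g : fm_sp f) : fm_sp (f + 1) :=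
  [ffun t => \sum_(s : word f) (g s * wcoef i (wval s)) *+ (wval t == wins i (wval s))].

Lemma fm_lin f i : klinear (@fm_act f i).
Proof.
move=> a u v; apply/ffunP => t; rewrite !ffunE scaler_sumr -big_split.
apply: eq_bigr => s _ /=; rewrite !ffunE -scalerMnr -mulrnDl; congr (_ *+ _).
by rewrite /GRing.scale /=; ring.
Qed.

Lemma fm_act2 f (i j : 'I_n) (g : fm_sp f) t : fm_act j (fm_act i g) t =
  \sum_(s : word f) (g s * (wcoef i (wval s) * wcoef j (wins i (wval s))))
     *+ (wval t == wins j (wins i (wval s))).
Proof.
rewrite ffunE; under eq_bigr do rewrite ffunE mulr_suml -sumrMnl.
rewrite exchange_big; apply: eq_bigr => s _ /=.
have ds : wdeg d (wins i (wval s)) = f + 1 by rewrite wdeg_wins wval_deg.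
rewrite -(sum_word (fun u => (g s * (wcoef i (wval s) * wcoef j u)) *+ (wval t == wins j u))
  (wins_sorted i (wval_sorted s)) ds).
apply: eq_bigr => u _; rewrite mulrnAl -mulrA.
by rewrite -!mulrnA mulnC.
Qed.

Lemma fm_rel f (i j : 'I_n) (g : fm_sp f) :
  fm_act j (fm_act i g) = w i j *: fm_act i (fm_act j g).
Proof.
apply/ffunP => t; rewrite [RHS]ffunE !fm_act2 scaler_sumr; apply: eq_bigr => s _.
by rewrite wins_comm wcoef_comm -scalerMnr /GRing.scale /=; congr (_ *+ _); ring.
Qed.

Definition fm : grmod w := GrMod fm_lin fm_rel.

Definition fm_bas f (s : seq 'I_n) : gm_sp fm f := [ffun t => (wval t == s)%:R].
Definition fm_gen : gm_sp fm d := fm_bas d [::].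

Lemma fm_basE f (g : gm_sp fm f) : g = \sum_(s : word f) g s *: fm_bas f (wval s).
Proof.
apply/ffunP => t; rewrite sum_ffunE (bigD1 t) //= !ffunE eqxx big1 => [|s st].
  by rewrite addr0 /GRing.scale /= mulr1.
by rewrite !ffunE (inj_eq (@wval_inj f)) eq_sym (negbTE st) /GRing.scale /= mulr0.
Qed.

Lemma fm_act_bas f i s : word_sorted (i :: s) -> wdeg d s = f ->
  gm_act fm f i (fm_bas f s) = fm_bas (f + 1) (i :: s).
Proof.
move=> is_sorted ds; have [wE cE] := wins_head is_sorted.
have ss : word_sorted s by apply: path_sorted is_sorted.
apply/ffunP => t; rewrite !ffunE.
transitivity (wcoef i s *+ (wval t == wins i s)); last by rewrite cE wE.
rewrite -(sum_word (fun u => wcoef i u *+ (wval t == wins i u)) ss ds).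
apply: eq_bigr => u _; rewrite ffunE mulrC mulr_natr.
by rewrite -!mulrnA mulnC.
Qed.

Lemma fm_ext (M : grmod w) (h h' : grhom fm M) :
  gh_fun h d fm_gen = gh_fun h' d fm_gen -> h = h'.
Proof.
move=> e; apply: hom_ext => f g; rewrite (fm_basE g).
rewrite !(klin_sum (gh_lin _ (d := f))); apply: eq_bigr => s _; rewrite !homZ; congr (_ *: _).
move: (wval s) (wval_sorted s) (wval_deg s) => {g}u; elim: u f {s} => [|i u IH] f su du.
  by simpl in du; subst f.
have su' : word_sorted u by apply: path_sorted su.
by rewrite -du /= -fm_act_bas // !gh_comm IH.
Qed.

Lemma fm_span (x : gm_sp fm d) : exists a, x = a *: fm_gen.
Proof.
have [t0 t0E] := @word_of d [::] isT erefl.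
have all0 (t : word d) : wval t = [::].
  by apply/nilP; have := wval_deg t; rewrite wdegE /nilp; lia.
exists (x t0); apply/ffunP => t; rewrite !ffunE all0 eqxx /GRing.scale /= mulr1.
by congr (x _); apply: wval_inj; rewrite t0E all0.
Qed.

Lemma fm_gen_neq0 : fm_gen != 0.
Proof.
have [t tE] := @word_of d [::] isT erefl.
by apply/eqP => /ffunP/(_ t); rewrite !ffunE tE eqxx => /eqP; rewrite oner_eq0.
Qed.

Lemma fm_below f (x : gm_sp fm f) : (f < d) -> x = 0.
Proof.
by move=> fd; apply/ffunP => t; have := wval_deg t; rewrite wdegE; lia.
Qed.

Lemma fm_above f (o : 'I_n) : d <= f -> exists x : gm_sp fm f, x != 0.
Proof.
move=> df; pose s := nseq `|f - d|%N o.
have ss : word_sorted s.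
  by rewrite /s /word_sorted; elim: `|f - d|%N => //= -[|m] //= ->; rewrite leqnn.
have ds : wdeg d s = f by rewrite wdegE size_nseq; lia.
have [t tE] := word_of ss ds; exists (fm_bas f s).
by apply/eqP => /ffunP/(_ t); rewrite !ffunE tE eqxx => /eqP; rewrite oner_eq0.
Qed.

Definition fm_x (i : 'I_n) : gm_sp fm (d + 1) := gm_act fm d i fm_gen.

Lemma fm_x_coord (c : 'I_n -> k) (j : 'I_n) :
  exists t : word (d + 1), wval t = [:: j] /\ (\sum_i c i *: fm_x i) t = c j.
Proof.
have [t tE] := @word_of (d + 1) [:: j] isT erefl; exists t; split=> //.
rewrite sum_ffunE (bigD1 j) //= big1 => [|i ij];
  rewrite /fm_x fm_act_bas // !ffunE tE /GRing.scale /=.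
  by rewrite eqxx mulr1 addr0.
by rewrite eqseq_cons eqxx andbT eq_sym (negbTE ij) mulr0.
Qed.

Lemma fm_x_free (c c' : 'I_n -> k) :
  \sum_i c i *: fm_x i = \sum_i c' i *: fm_x i -> c =1 c'.
Proof.
move=> e j; have [t [tE <-]] := fm_x_coord c j; have [t' [tE' <-]] := fm_x_coord c' j.
by rewrite e; congr (_ _); apply: wval_inj; rewrite tE.
Qed.

Lemma fm_x_span (x : gm_sp fm (d + 1)) : exists c, x = \sum_i c i *: fm_x i.
Proof.
exists (fun i => \sum_(t : word (d + 1)) x t *+ (wval t == [:: i])).
rewrite {1}(fm_basE x); under [RHS]eq_bigr do rewrite scaler_suml.
rewrite exchange_big; apply: eq_bigr => t _.
have : size (wval t) = 1%N by have := wval_deg t; rewrite wdegE; lia.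
case: (wval t) => [|i [|//]] // _; rewrite (bigD1 i) //= eqxx big1 ?addr0 => [|j ji].
  by rewrite /fm_x fm_act_bas.
by rewrite eqseq_cons eqxx andbT eq_sym (negbTE ji) scale0r.
Qed.

Section Universal.
Variables (M : grmod w) (m : gm_sp M d).

Fixpoint wact (s : seq 'I_n) : gm_sp M (wdeg d s) :=
  if s is i :: s' then gm_act M _ i (wact s') else m.

(** The straightening rule of sorted words holds in every module; [dcast] bridges degrees that are
    equal but not convertible. *)
Lemma wact_wins i s :
  gm_act M _ i (wact s) = wcoef i s *: dcast (wdeg d s + 1) (wact (wins i s)).
Proof.
elim: s => [|j s IH] /=; first by rewrite dcast_id scale1r.
case: leqP => [ji|ij] /=; first by rewrite dcast_id scale1r.
by rewrite gm_rel IH actZ scalerA act_dcast // wdeg_wins.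
Qed.

Definition fm_map_fun f (g : fm_sp f) : gm_sp M f :=
  \sum_(s : word f) g s *: dcast f (wact (wval s)).

Lemma fm_map_lin f : klinear (@fm_map_fun f).
Proof.
move=> a u v; rewrite /fm_map_fun scaler_sumr -big_split; apply: eq_bigr => s _ /=.
by rewrite !ffunE scalerDl scalerA.
Qed.

Lemma fm_map_comm f i (g : fm_sp f) :
  fm_map_fun (fm_act i g) = gm_act M f i (fm_map_fun g).
Proof.
rewrite /fm_map_fun (klin_sum (@gm_lin _ _ _ M f i)).
under eq_bigr do rewrite ffunE scaler_suml.
rewrite exchange_big; apply: eq_bigr => s _ /=.
have ds := wval_deg s.
have dws : wdeg d (wins i (wval s)) = f + 1 by rewrite wdeg_wins ds.
rewrite actZ act_dcast // wact_wins dcastZ scalerA.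
transitivity ((g s * wcoef i (wval s)) *: dcast (f + 1) (wact (wins i (wval s)))).
  rewrite -(sum_word (fun u => (g s * wcoef i (wval s)) *: dcast (f + 1) (wact u))
    (wins_sorted i (wval_sorted s)) dws).
  by apply: eq_bigr => t _; exact: esym (scalerMnl _ _ _).
by rewrite dcast_trans // wdeg_wins.
Qed.

Definition fm_map : grhom fm M := @GrHom k n w fm M _ fm_map_lin fm_map_comm.

Lemma fm_map_gen : gh_fun fm_map d fm_gen = m.
Proof.
rewrite /= /fm_map_fun -[RHS](dcast_id m).
rewrite -(sum_word (fun u => dcast d (wact u)) (isT : word_sorted [::]) (erefl : wdeg d [::] = d)).
by apply: eq_bigr => s _; rewrite ffunE; exact: scaler_nat.
Qed.
End Universal.
End Word.
End FreeModule.

(** * Equivalences preserve sums *)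

Section Faithful.
Variables (k : fieldType) (n n' : nat) (w : 'M[k]_n) (w' : 'M[k]_n').
Variables (F : functor w w') (G : functor w' w).
Hypothesis eta : natiso (fcomp G F) (fid w).

(** Naturality recovers a morphism from its image under F, which makes F faithful. *)
Lemma natiso_conj (M N : grmod w) (f : grhom M N) :
  f = hcomp (ni_fwd eta N) (hcomp (F_hom G (F_hom F f)) (ni_bwd eta M)).
Proof.
apply: hom_ext => d m; have := ni_nat eta f (gh_fun (ni_bwd eta M) d m).
by rewrite /= => <-; have := ni_fb eta m => /= ->.
Qed.

Lemma F_faithful (M N : grmod w) (f g : grhom M N) : F_hom F f = F_hom F g -> f = g.
Proof. by move=> e; rewrite (natiso_conj f) e -natiso_conj. Qed.

Lemma natiso_hiso (M : grmod w) : hiso (F_obj G (F_obj F M)) M.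
Proof.
exists (ni_fwd eta M), (ni_bwd eta M).
by split; apply: hom_ext; [exact: (@ni_bf _ _ _ _ _ _ _ eta M) | exact: (@ni_fb _ _ _ _ _ _ _ eta M)].
Qed.
End Faithful.

Lemma F_hom_id (k : fieldType) (n n' : nat) (w : 'M[k]_n) (w' : 'M[k]_n')
  (F : functor w w') M : F_hom F (hid M) = hid (F_obj F M).
Proof. exact: hom_ext (@F_id _ _ _ _ _ F M). Qed.

Lemma F_homM (k : fieldType) (n n' : nat) (w : 'M[k]_n) (w' : 'M[k]_n')
  (F : functor w w') M N P (g : grhom N P) (f : grhom M N) :
  F_hom F (hcomp g f) = hcomp (F_hom F g) (F_hom F f).
Proof. exact: hom_ext (@F_comp _ _ _ _ _ F _ _ _ g f). Qed.

Lemma F_hiso (k : fieldType) (n n' : nat) (w : 'M[k]_n) (w' : 'M[k]_n')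
  (F : functor w w') M N : hiso M N -> hiso (F_obj F M) (F_obj F N).
Proof.
case=> a [b [ba ab]]; exists (F_hom F a), (F_hom F b).
by rewrite -!F_homM ba ab !F_hom_id.
Qed.

Section Equivalence.
Variables (k : fieldType) (n n' : nat) (w : 'M[k]_n) (w' : 'M[k]_n').
Variables (F : functor w w') (G : functor w' w).
Hypotheses (eta : natiso (fcomp G F) (fid w)) (eps : natiso (fcomp F G) (fid w')).

Lemma F_full (M N : grmod w) (h : grhom (F_obj F M) (F_obj F N)) :
  exists f, F_hom F f = h.
Proof.
pose f := hcomp (ni_fwd eta N) (hcomp (F_hom G h) (ni_bwd eta M)).
(* [eps] makes G faithful, so it is enough to compare images under G; naturality of [eta] at [f]
   does that. *)
exists f; apply: (F_faithful eps); apply: hom_ext => d m.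
have := ni_nat eta f m; rewrite /= /f /=.
have := ni_bf eta m; rewrite /= => ->.
move/(congr1 (gh_fun (ni_bwd eta N) d)).
have := ni_bf eta (gh_fun (F_hom G h) d m); rewrite /= => ->.
by have := ni_bf eta (gh_fun (F_hom G (F_hom F f)) d m); rewrite /= => ->.
Qed.

Lemma F_ess (X : grmod w') : exists M, hiso (F_obj F M) X.
Proof. by exists (F_obj G X); apply: natiso_hiso eps X. Qed.

(* Zero morphisms are those that equalize any two endomorphisms of the source. *)
Lemma F_hzero (M N : grmod w) : F_hom F (hzero M N) = hzero _ _.
Proof.
have [z zE] := F_full (hzero (F_obj F M) (F_obj F M)).
have -> : hzero M N = hcomp (hzero M N) z by apply: hom_ext.
by rewrite F_homM zE; apply: hom_ext => d m /=; rewrite hom0.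
Qed.

Lemma F_neq0 (M N : grmod w) (f : grhom M N) : f <> hzero M N -> F_hom F f <> hzero _ _.
Proof. by move=> f0; rewrite -F_hzero => /(F_faithful eta). Qed.

(* Equivalences preserve biproducts, hence sums of parallel morphisms. *)
Lemma F_hadd (M N : grmod w) (f g : grhom M N) :
  F_hom F (hadd f g) = hadd (F_hom F f) (F_hom F g).
Proof.
pose p1 := dfst N N; pose p2 := dsnd N N.
pose i1 := hpair (hid N) (hzero N N); pose i2 := hpair (hzero N N) (hid N).
have p1i1 : hcomp p1 i1 = hid N by apply: hom_ext.
have p2i2 : hcomp p2 i2 = hid N by apply: hom_ext.
have p1i2 : hcomp p1 i2 = hzero N N by apply: hom_ext.
have p2i1 : hcomp p2 i1 = hzero N N by apply: hom_ext.
have hcompDr A B C (a : grhom B C) (b c : grhom A B) :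
    hcomp a (hadd b c) = hadd (hcomp a b) (hcomp a c).
  by apply: hom_ext => d m /=; rewrite (klinD (gh_lin a (d := d))).
(* Additivity is not yet available, so the sum is lifted to some [h] by fullness, and [h] is
   compared with the identity after both projections. *)
have id_split : hadd (hcomp (F_hom F i1) (F_hom F p1)) (hcomp (F_hom F i2) (F_hom F p2))
    = hid (F_obj F (dsum N N)).
  have [h hE] := F_full (hadd (hcomp (F_hom F i1) (F_hom F p1))
                              (hcomp (F_hom F i2) (F_hom F p2))).
  have e1 : hcomp p1 h = p1.
    apply: (F_faithful eta); rewrite F_homM hE hcompDr !hcompA -!F_homM p1i1 p1i2.
    by rewrite !F_homM F_hzero F_hom_id hcomp1f; apply: hom_ext => d m /=; rewrite addr0.
  have e2 : hcomp p2 h = p2.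
    apply: (F_faithful eta); rewrite F_homM hE hcompDr !hcompA -!F_homM p2i1 p2i2.
    by rewrite !F_homM F_hzero F_hom_id hcomp1f; apply: hom_ext => d m /=; rewrite add0r.
  rewrite -hE; have -> : h = hid _; last by rewrite F_hom_id.
  apply: hom_ext => d m; have := hom_app m e1; have := hom_app m e2.
  by case: m => m1 m2 /=; case: (gh_fun h d _) => a b /= -> ->.
have sum_split : F_hom F (hadd p1 p2) = hadd (F_hom F p1) (F_hom F p2).
  rewrite -[LHS]hcompf1 -id_split hcompDr !hcompA -!F_homM.
  by congr (hadd (F_hom F _) (F_hom F _)); apply: hom_ext => d m /=; rewrite ?addr0 ?add0r.
have -> : hadd f g = hcomp (hadd p1 p2) (hpair f g) by apply: hom_ext.
rewrite F_homM sum_split.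
have -> : F_hom F f = hcomp (F_hom F p1) (F_hom F (hpair f g)).
  by rewrite -F_homM; congr (F_hom F _); apply: hom_ext.
have -> : F_hom F g = hcomp (F_hom F p2) (F_hom F (hpair f g)).
  by rewrite -F_homM; congr (F_hom F _); apply: hom_ext.
by apply: hom_ext.
Qed.

Lemma F_hsum (M N : grmod w) (I : Type) (r : seq I) (f : I -> grhom M N) :
  F_hom F (\big[@hadd _ _ _ M N/hzero M N]_(i <- r) f i) =
  \big[@hadd _ _ _ _ _/hzero _ _]_(i <- r) F_hom F (f i).
Proof. exact: (big_morph _ (@F_hadd M N) (F_hzero M N)). Qed.

(** F may act on scalars in an unknown way, but natural multiples are repeated sums. *)
Lemma F_hscale_nat (M N : grmod w) (t : nat) (f : grhom M N) :
  F_hom F (hscale t%:R f) = hscale t%:R (F_hom F f).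
Proof.
elim: t => [|t IH].
  have -> : hscale 0%:R f = hzero M N by apply: hom_ext => d m /=; rewrite scale0r.
  by rewrite F_hzero; apply: hom_ext => d m /=; rewrite scale0r.
have -> : hscale t.+1%:R f = hadd (hscale t%:R f) f.
  by apply: hom_ext => d m /=; rewrite -natr1 scalerDl scale1r.
by rewrite F_hadd IH; apply: hom_ext => d m /=; rewrite -natr1 scalerDl scale1r.
Qed.
End Equivalence.

Lemma hsum_app (k : fieldType) (n : nat) (w : 'M[k]_n) (M N : grmod w) (I : Type) (r : seq I)
  (f : I -> grhom M N) d m :
  gh_fun (\big[@hadd _ _ _ M N/hzero M N]_(i <- r) f i) d m = \sum_(i <- r) gh_fun (f i) d m.
Proof. exact: (big_morph (fun h => gh_fun h d m)). Qed.

(** * Images of simple and free modules *)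

Section SimpleHoms.
Variables (k : fieldType) (n : nat) (w : 'M[k]_n).

Lemma hcomp_hzero (M N P : grmod w) (f : grhom N P) : hcomp f (hzero M N) = hzero M P.
Proof. by apply: hom_ext => d m /=; rewrite hom0. Qed.

Lemma hzero_hcomp (M N P : grmod w) (f : grhom M N) : hcomp (hzero N P) f = hzero M P.
Proof. exact: hom_ext. Qed.

(** Simplicity in a form that an equivalence preserves: nonzero morphisms out of [kk] are mono. *)
Lemma kk_mono (d : int) (X Y : grmod w) (h : grhom X (kk w d)) (f : grhom (kk w d) Y) :
  f <> hzero _ _ -> hcomp f h = hzero _ _ -> h = hzero _ _.
Proof.
move=> f0 fh; apply: hom_ext => e x; case: (e =P d) => [E|E]; last exact: kk_off E.
subst e; have := hom_app x fh; rewrite /=.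
have [a ->] := kk_span (gh_fun h d x); rewrite homZ => /eqP.
rewrite scaler_eq0 => /orP[/eqP->|/eqP f1]; first by rewrite scale0r.
by case: f0; apply: kk_ext; rewrite f1.
Qed.

Lemma kk_lift (d : int) (Z : grmod w) (h : grhom Z (kk w d)) :
  h <> hzero _ _ -> exists z, gh_fun h d z = kk1 w d.
Proof.
case/hom_neq0 => e [m hm]; case: (e =P d) => [E|E]; last first.
  by rewrite (kk_off (gh_fun h e m) E) eqxx in hm.
subst e; have [a ha] := kk_span (gh_fun h d m).
have a0 : a != 0 by apply: contraNneq hm => a0; rewrite ha a0 scale0r.
by exists (a^-1 *: m); rewrite homZ ha scalerA mulVf // scale1r.
Qed.

Lemma hiso_hom_neq0 (A A' B B' : grmod w) : hiso A A' -> hiso B B' ->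
  (exists h : grhom A B, h <> hzero _ _) -> exists h : grhom A' B', h <> hzero _ _.
Proof.
move=> [a [a' [a'a aa']]] [b [b' [b'b bb']]] [h h0].
exists (hcomp b (hcomp h a')) => e; apply: h0.
rewrite -[h]hcomp1f -b'b -[h]hcompf1 -a'a -!hcompA (hcompA h) (hcompA b) e.
by rewrite hzero_hcomp hcomp_hzero.
Qed.

(** This reads the order of degrees off the category; powers of the variable [o] provide the nonzero
    morphisms. *)
Lemma fm_hom_neq0 (hw : cube_skew w) (o : 'I_n) (d f : int) :
  (exists h : grhom (fm hw f) (fm hw d), h <> hzero _ _) <-> d <= f.
Proof.
split=> [[h h0]|df].
  rewrite leNgt; apply/negP => fd; apply: h0; apply: fm_ext.
  exact: fm_below fd.
have [x x0] := fm_above hw o df; exists (fm_map hw x) => /(hom_app (fm_gen hw f)).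
by rewrite fm_map_gen => /eqP; rewrite (negbTE x0).
Qed.
End SimpleHoms.

Section SimpleImage.
Variables (k : fieldType) (n : nat) (w w' : 'M[k]_n).
Variables (F : functor w w') (G : functor w' w).
Hypotheses (eta : natiso (fcomp G F) (fid w)) (eps : natiso (fcomp F G) (fid w')).
Variable d : int.
Let X := F_obj F (kk w d).

Lemma F_kk_mono (A B : grmod w') (u : grhom A X) (v : grhom X B) :
  v <> hzero _ _ -> hcomp v u = hzero _ _ -> u = hzero _ _.
Proof.
move=> v0 vu; have [B0 [b [b' [b'b bb']]]] := F_ess eps B.
have [A0 [a [a' [a'a aa']]]] := F_ess eps A.
have [v1 v1E] := F_full eta eps (hcomp b' v).
have [u1 u1E] := F_full eta eps (hcomp u a).
have v10 : v1 <> hzero _ _.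
  move=> e; apply: v0; rewrite -[v]hcomp1f -bb' -hcompA -v1E e.
  by rewrite (F_hzero eta eps) hcomp_hzero.
have /(kk_mono v10) u10 : hcomp v1 u1 = hzero _ _.
  apply: (F_faithful eta); rewrite F_homM v1E u1E -hcompA (hcompA v) vu.
  by rewrite hzero_hcomp hcomp_hzero (F_hzero eta eps).
by rewrite -[u]hcompf1 -aa' hcompA -u1E u10 (F_hzero eta eps) hzero_hcomp.
Qed.

(** The part above e includes into [X], and [X] projects onto the part up to e. Both maps are
    nonzero with zero composite, against [F_kk_mono]. *)
Lemma F_kk_two_degrees (e e' : int) (m : gm_sp X e) (m' : gm_sp X e') :
  m != 0 -> m' != 0 -> e < e' -> False.
Proof.
move=> m0 m'0 ee'.
have dn (f : int) : f + 1 <= e -> f <= e by lia.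
have up (f : int) : e < f -> e < f + 1 by lia.
pose v := to_res X (D := fun f => f <= e) dn.
pose u := of_res X (D := fun f => e < f) up.
have v0 : v <> hzero _ _.
  move/(hom_app m) => /= /(congr1 (@res_out _ _ _ _ _ _)).
  rewrite res_outK lexx (klin0 (@res_out_lin _ _ _ _ _ _)) => /eqP.
  by rewrite (negbTE m0).
have /(F_kk_mono v0) : hcomp v u = hzero _ _.
  apply: hom_ext => f x /=; have [fe|fe] := boolP (f <= e); last first.
    by rewrite res_in_eq0 //; apply: negbTE.
  rewrite res_out_eq0 ?(klin0 (@res_in_lin _ _ _ _ _ _)) //.
  by apply/negbTE; rewrite -leNgt.
move/(hom_app (M := res X (fun f => e < f)) (d := e') (res_in _ m')) => /=; rewrite res_outK ee' => /eqP.
by rewrite (negbTE m'0).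
Qed.

Lemma F_kk_concentrated : exists e, (exists m : gm_sp X e, m != 0) /\
  forall e' (m : gm_sp X e'), e' <> e -> m = 0.
Proof.
have [e [m hm]] : exists e m, gh_fun (F_hom F (hid (kk w d))) e m != 0.
  apply: hom_neq0; apply: (F_neq0 eta eps) => /(hom_app (kk1 w d)) /= /eqP.
  by rewrite (negbTE (kk1_neq0 _ _)).
have m0 : m != 0 by apply: contraNneq hm => ->; rewrite hom0.
exists e; split=> [|e' m' ne]; first by exists m.
apply/eqP/negP => /negP m'0.
case: (ltgtP e e') => // [lt|lt|E]; last by rewrite E in ne.
  exact: F_kk_two_degrees m0 m'0 lt.
exact: F_kk_two_degrees m'0 m0 lt.
Qed.
End SimpleImage.

Section ProjectiveImage.
Variables (k : fieldType) (n : nat) (w w' : 'M[k]_n).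
Hypotheses (hw : cube_skew w) (hw' : cube_skew w').
Variables (F : functor w w') (G : functor w' w).
Hypotheses (eta : natiso (fcomp G F) (fid w)) (eps : natiso (fcomp F G) (fid w')).

(** The image lives in one degree, so a nonzero element gives a map [u] from a simple module. Pulled
    back along F, [u] becomes a nonzero map to [kk w d] from a module living in one degree, and such
    a map splits. *)
Lemma F_kk (d : int) : exists e, hiso (kk w' e) (F_obj F (kk w d)).
Proof.
have [e [[m m0] conc]] := F_kk_concentrated eta eps d.
have m_soc i : gm_act (F_obj F (kk w d)) e i m = 0 by apply: conc; lia.
pose u := kk_map m_soc; exists e.
pose Y := F_obj G (kk w' e); have [a [a' [a'a aa']]] := natiso_hiso eps (kk w' e).
have [d' [_ concY]] := F_kk_concentrated eps eta e.
have [u' u'E] := F_full eta eps (hcomp u a : grhom (F_obj F Y) _).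
have /kk_lift[y yE] : u' <> hzero _ _.
  move=> u'0; move: m0; rewrite -(kk_map1 m_soc) -/u -[u]hcompf1 -aa' hcompA -u'E u'0.
  by rewrite (F_hzero eta eps) eqxx.
have dd' : d = d'.
  apply/eqP/negP => /negP/eqP ne; move: (kk1_neq0 w d).
  by rewrite -yE (concY _ y ne) hom0 eqxx.
have y_soc i : gm_act Y d i y = 0 by apply: concY; lia.
pose t := hcomp a (F_hom F (kk_map y_soc)).
have ut : hcomp u t = hid _.
  rewrite /t hcompA -u'E -F_homM -F_hom_id; congr (F_hom F _).
  by apply: kk_ext; rewrite hcompE kk_map1 yE.
exists u, t; split=> //; apply: kk_ext.
(* The other composite is a scalar c, and [ut] forces c m = m. *)
have [c cE] := kk_span (gh_fun (hcomp t u) e (kk1 w' e)); rewrite cE.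
have := hom_app (gh_fun u e (kk1 w' e)) ut; rewrite hcompE -(hcompE t u) cE.
rewrite homZ /u kk_map1 /= => /eqP; rewrite -subr_eq0 -{2}[m]scale1r -scalerBl.
rewrite scaler_eq0 (negbTE m0) orbF subr_eq0 => /eqP ->.
by rewrite scale1r.
Qed.

(** An endomorphism scales the generator, and [pi] detects the scalar. *)
Lemma fm_end_id (v : 'M[k]_n) (hv : cube_skew v) d (h : grhom (fm hv d) (fm hv d)) :
  let pi := fm_map hv (kk1 v d) in hcomp pi h = pi -> h = hid _.
Proof.
move=> pi e; apply: fm_ext; have [a aE] := fm_span (gh_fun h d (fm_gen hv d)).
have := hom_app (fm_gen hv d) e; rewrite hcompE aE homZ fm_map_gen => /eqP.
rewrite -subr_eq0 -{2}[kk1 v d]scale1r -scalerBl scaler_eq0 (negbTE (kk1_neq0 _ _)).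
by rewrite orbF subr_eq0 => /eqP->; rewrite scale1r.
Qed.

(* fm d is the projective cover of kk d: both fm' e and F (fm d) map onto
   kk' e, and these maps lift to each other. *)
Lemma F_fm_of_kk (d e : int) :
  hiso (kk w' e) (F_obj F (kk w d)) -> hiso (fm hw' e) (F_obj F (fm hw d)).
Proof.
case=> u [t [tu ut]].
pose pi := fm_map hw (kk1 w d); pose pi' := fm_map hw' (kk1 w' e).
have pi0 : pi <> hzero _ _.
  move/(hom_app (fm_gen hw d)); rewrite fm_map_gen => /eqP.
  by rewrite (negbTE (kk1_neq0 _ _)).
have pi'0 : pi' <> hzero _ _.
  move/(hom_app (fm_gen hw' e)); rewrite fm_map_gen => /eqP.
  by rewrite (negbTE (kk1_neq0 _ _)).
have [z zE] : exists z, gh_fun (hcomp t (F_hom F pi)) e z = kk1 w' e.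
  apply: kk_lift => e0; apply: (F_neq0 eta eps pi0).
  by rewrite -[F_hom F pi]hcomp1f -ut -hcompA e0 hcomp_hzero.
pose a := fm_map hw' z.
have aE : hcomp (hcomp t (F_hom F pi)) a = pi'.
  by apply: fm_ext; rewrite hcompE fm_map_gen zE fm_map_gen.
(* For the opposite lift [fm hw' e] is replaced by the isomorphic F Z, so that freeness of [fm hw d]
   can be used before F is applied. *)
pose Z := F_obj G (fm hw' e); have [c [c' [c'c cc']]] := natiso_hiso eps (fm hw' e).
have [v vE] := F_full eta eps (hcomp (hcomp u pi') c : grhom (F_obj F Z) _).
have [z' z'E] : exists z', gh_fun v d z' = kk1 w d.
  apply: kk_lift => v0; apply: pi'0.
  rewrite -[pi']hcomp1f -tu -hcompA -[hcomp u pi']hcompf1 -cc' (hcompA (hcomp u pi')) -vE v0.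
  by rewrite (F_hzero eta eps) hzero_hcomp hcomp_hzero.
pose b := hcomp c (F_hom F (fm_map hw z')).
have bE : hcomp pi' b = hcomp t (F_hom F pi).
  rewrite -[hcomp pi' b]hcomp1f -tu -hcompA; congr (hcomp t _).
  rewrite /b !hcompA -vE -F_homM; congr (F_hom F _).
  by apply: fm_ext; rewrite hcompE !fm_map_gen z'E.
exists a, b; split.
  by apply: fm_end_id; rewrite hcompA bE aE.
have [h hE] := F_full eta eps (hcomp a b); rewrite -hE -F_hom_id; congr (F_hom F _).
apply: fm_end_id; apply: (F_faithful eta); rewrite F_homM hE -[LHS]hcomp1f -ut.
rewrite -!hcompA (hcompA t) (hcompA _ a) aE bE -[RHS]hcomp1f -ut.
by rewrite -hcompA.
Qed.

Lemma F_fm (d : int) : exists e, hiso (fm hw' e) (F_obj F (fm hw d)).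
Proof. by have [e /F_fm_of_kk ?] := F_kk d; exists e. Qed.
End ProjectiveImage.

Section Shift.
Variables (k : fieldType) (n : nat) (w w' : 'M[k]_n).
Hypotheses (hw : cube_skew w) (hw' : cube_skew w').
Variables (F : functor w w') (G : functor w' w).
Hypotheses (eta : natiso (fcomp G F) (fid w)) (eps : natiso (fcomp F G) (fid w')).
Variable o : 'I_n.

Lemma F_fm_onto (e : int) : exists d, hiso (fm hw' e) (F_obj F (fm hw d)).
Proof.
have [d isod] := F_fm hw' hw eps eta e; exists d.
by apply: hiso_sym; apply: hiso_trans (F_hiso F isod) (natiso_hiso eps _).
Qed.

Lemma F_fm_mono (d e f g : int) :
  hiso (fm hw' e) (F_obj F (fm hw d)) -> hiso (fm hw' g) (F_obj F (fm hw f)) ->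
  (d <= f) = (e <= g).
Proof.
move=> de fg; apply/idP/idP => [/(fm_hom_neq0 hw o)|/(fm_hom_neq0 hw' o)].
  case=> h h0; apply/(fm_hom_neq0 hw' o).
  apply: (hiso_hom_neq0 (hiso_sym fg) (hiso_sym de)).
  by exists (F_hom F h); apply: (F_neq0 eta eps).
move/(hiso_hom_neq0 fg de) => [h h0]; apply/(fm_hom_neq0 hw o).
have [h' h'E] := F_full eta eps h; exists h' => h'0; apply: h0.
by rewrite -h'E h'0 (F_hzero eta eps).
Qed.

(** The correspondence of degrees is an order embedding of the integers and is onto, hence it
    preserves successors. *)
Lemma F_fm_succ (d e : int) : hiso (fm hw' e) (F_obj F (fm hw d)) ->
  hiso (fm hw' (e + 1)) (F_obj F (fm hw (d + 1))).
Proof.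
move=> de; have [e' de'] := F_fm hw hw' eta eps (d + 1).
have [f fe] := F_fm_onto (e + 1).
have h1 := F_fm_mono de' de; have h2 := F_fm_mono fe de; have h3 := F_fm_mono de' fe.
suff -> : e + 1 = e' by [].
move: h1 h2 h3; lia.
Qed.
End Shift.

(** * Transfer of points *)

Section Transfer.
Variables (k : fieldType) (n : nat) (w w' : 'M[k]_n).
Hypotheses (hw : cube_skew w) (hw' : cube_skew w').
Variables (F : functor w w') (G : functor w' w).
Hypotheses (eta : natiso (fcomp G F) (fid w)) (eps : natiso (fcomp F G) (fid w')).

Definition xhom (d : int) (i : 'I_n) : grhom (fm hw (d + 1)) (fm hw d) :=
  fm_map hw (fm_x hw d i).

Section Level.
Variables (d e : int).
Variables (a : grhom (fm hw' e) (F_obj F (fm hw d))).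
Variables (b : grhom (F_obj F (fm hw d)) (fm hw' e)).
Hypotheses (ba : hcomp b a = hid _) (ab : hcomp a b = hid _).

(* Equivalences need not be k-linear: F carries the scalar c to s. *)
Lemma F_scalar (c : k) : exists2 s, (c != 0 -> s != 0) &
  gh_fun (F_hom F (hscale c (hid (fm hw d)))) e (gh_fun a e (fm_gen hw' e)) =
  s *: gh_fun a e (fm_gen hw' e).
Proof.
set h := F_hom F _.
have [s sE] := fm_span (gh_fun b e (gh_fun h e (gh_fun a e (fm_gen hw' e)))).
have hE : gh_fun h e (gh_fun a e (fm_gen hw' e)) = s *: gh_fun a e (fm_gen hw' e).
  by rewrite -homZ -sE -(hcompE a b) ab.
exists s => //; apply: contraNneq => s0.
have h0 : h = hzero _ _.
  rewrite -[h]hcompf1 -ab hcompA -(hzero_hcomp (F_obj F (fm hw d)) b); congr (hcomp _ b).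
  by apply: fm_ext; rewrite hcompE hE s0 scale0r.
have := F_neq0 eta eps (f := hscale c (hid (fm hw d))); rewrite -/h h0 => H.
apply/eqP; apply: NNPP => c0; apply: H => // /(hom_app (fm_gen hw d)) /= /eqP.
by rewrite scaler_eq0 (negbTE (fm_gen_neq0 hw d)) orbF => /eqP.
Qed.
End Level.

Variables (d e : int).
Variables (a0 : grhom (fm hw' e) (F_obj F (fm hw d))).
Variables (b0 : grhom (F_obj F (fm hw d)) (fm hw' e)).
Hypotheses (ba0 : hcomp b0 a0 = hid _) (ab0 : hcomp a0 b0 = hid _).
Variables (a1 : grhom (fm hw' (e + 1)) (F_obj F (fm hw (d + 1)))).
Variables (b1 : grhom (F_obj F (fm hw (d + 1))) (fm hw' (e + 1))).
Hypotheses (ba1 : hcomp b1 a1 = hid _) (ab1 : hcomp a1 b1 = hid _).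

Let gen1 := gh_fun a1 (e + 1) (fm_gen hw' (e + 1)).

(** The rows exist because the images of the variables have degree one. Fullness writes each
    variable of [w'] in terms of these rows, which gives a left inverse. *)
Lemma transfer_matrix : exists2 A : 'M[k]_n, A \in unitmx &
  forall i, gh_fun (F_hom F (xhom d i)) (e + 1) gen1 =
    gh_fun a0 (e + 1) (\sum_j A i j *: fm_x hw' e j).
Proof.
have /fin_all_exists[c cE] : forall i, exists c : 'I_n -> k,
    gh_fun b0 (e + 1) (gh_fun (F_hom F (xhom d i)) (e + 1) gen1) = \sum_j c j *: fm_x hw' e j.
  by move=> i; apply: fm_x_span.
pose A : 'M[k]_n := \matrix_(i, j) c i j.
have AE i : gh_fun b0 (e + 1) (gh_fun (F_hom F (xhom d i)) (e + 1) gen1) =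
    \sum_j A i j *: fm_x hw' e j.
  by rewrite cE; apply: eq_bigr => j _; rewrite mxE.
exists A; last by move=> i; rewrite -AE -(hcompE a0 b0) ab0.
have /fin_all_exists[s sE] : forall l, exists s : 'I_n -> k,
    fm_x hw' e l = \sum_i s i *: (\sum_j A i j *: fm_x hw' e j).
  move=> l; pose y := fm_map hw' (fm_x hw' e l).
  have [x xE] := F_full eta eps (hcomp a0 (hcomp y b1)).
  have [r rE] := fm_x_span (gh_fun x (d + 1) (fm_gen hw (d + 1))).
  have xsum : x = \big[@hadd _ _ _ _ _/hzero _ _]_i
      hcomp (xhom d i) (hscale (r i) (hid (fm hw (d + 1)))).
    apply: fm_ext; rewrite hsum_app rE; apply: eq_bigr => i _.
    by rewrite hcompE hscaleE homZ /xhom fm_map_gen.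
  (* The scalars that F makes of the [r i] are the entries of the left inverse. *)
  have /fin_all_exists[s sE] : forall i, exists s,
      gh_fun (F_hom F (hscale (r i) (hid (fm hw (d + 1))))) (e + 1) gen1 = s *: gen1.
    by move=> i; have [s _ sE] := F_scalar ab1 (r i); exists s.
  exists s; rewrite -[LHS](fm_map_gen hw' (fm_x hw' e l)) -/y.
  have -> : y = hcomp b0 (hcomp (F_hom F x) a1).
    by rewrite xE -!hcompA ba1 hcompf1 hcompA ba0 hcomp1f.
  rewrite !hcompE -/gen1 xsum (F_hsum eta eps) hsum_app (klin_sum (gh_lin b0 (d := e + 1))).
  by apply: eq_bigr => i _; rewrite F_homM hcompE sE !homZ AE.
suff /mulmx1_unit[] : (\matrix_(l, i) s l i) *m A = 1%:M by [].
apply/matrixP => l j; rewrite !mxE.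
have := fm_x_free (d := e) (hw := hw') (c := fun j => (l == j)%:R)
  (c' := fun j => \sum_i s l i * A i j) _ j => ->.
  by apply: eq_bigr => i _; rewrite mxE.
rewrite (bigD1 l) //= eqxx scale1r big1 ?addr0 => [|i]; last first.
  by rewrite eq_sym => /negbTE->; rewrite scale0r.
rewrite [LHS]sE; under [LHS]eq_bigr do rewrite scaler_sumr.
rewrite exchange_big; apply: eq_bigr => i _ /=; rewrite scaler_suml.
by apply: eq_bigr => m _; rewrite scalerA.
Qed.

(** Elements are encoded as morphisms out of free modules, so an action in [M] becomes an equation
    of composites to which F applies. *)
Lemma transfer_action (A : 'M[k]_n) :
  (forall i, gh_fun (F_hom F (xhom d i)) (e + 1) gen1 =
    gh_fun a0 (e + 1) (\sum_j A i j *: fm_x hw' e j)) ->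
  forall (M : grmod w) (u : grhom (fm hw d) M) (v : grhom (fm hw (d + 1)) M) i c s,
  gh_fun (F_hom F (hscale c (hid (fm hw (d + 1))))) (e + 1) gen1 = s *: gen1 ->
  hcomp u (xhom d i) = hscale c v ->
  \sum_j A i j *: gm_act (F_obj F M) e j
     (gh_fun (F_hom F u) e (gh_fun a0 e (fm_gen hw' e))) =
  s *: gh_fun (F_hom F v) (e + 1) gen1.
Proof.
move=> AE M u v i c s cs uv.
have {}uv : hcomp u (xhom d i) = hcomp v (hscale c (hid _)).
  by rewrite uv; apply: hom_ext => f m /=; rewrite homZ.
move/(congr1 (fun h => F_hom F h))/(hom_app gen1): uv.
rewrite !F_homM !hcompE AE cs homZ => <-.
rewrite !(klin_sum (gh_lin _ (d := e + 1))); apply: eq_bigr => j _.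
by rewrite !homZ /fm_x !gh_comm.
Qed.
End Transfer.

Section PointModule.
Variables (k : fieldType) (n : nat) (w : 'M[k]_n) (p q : 'I_n -> k).
Hypothesis pq : forall i j, p i * q j = w i j * (p j * q i).

(** A truncated point module: one dimension in every degree, with [p] and [q] acting out of degrees
    0 and 1 and zero action elsewhere. *)
Definition pt_coef (d : int) (i : 'I_n) : k :=
  if d == 0 then p i else if d == 0 + 1 then q i else 0.
Definition pt_act (d : int) (i : 'I_n) (m : k^o) : k^o := pt_coef d i *: m.
Lemma pt_lin d i : klinear (@pt_act d i).
Proof. by move=> a u v; rewrite /pt_act scalerDr !scalerA mulrC. Qed.
Lemma pt_rel d (i j : 'I_n) (m : k^o) :
  pt_act (d + 1) j (pt_act d i m) = w i j *: pt_act (d + 1) i (pt_act d j m).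
Proof.
rewrite /pt_act !scalerA; congr (_ *: _); rewrite /pt_coef.
case: (d =P 0) => [->|d0] /=; first by rewrite mulrC pq; ring.
case: (d =P 0 + 1) => [->|d1] /=; first by rewrite !mul0r mulr0 mul0r.
by rewrite !mulr0.
Qed.
Definition pt : grmod w := @GrMod k n w (fun _ => k^o) pt_act pt_lin pt_rel.
End PointModule.

Section PointTransfer.
Variables (k : fieldType) (n : nat) (w w' : 'M[k]_n).
Hypotheses (hw : cube_skew w) (hw' : cube_skew w').
Variable o : 'I_n.

(* The points p with a successor q are those of the point scheme; only vectors
   p over the prime ring are moved, so that F acts on them by the matrix A
   whatever it does to scalars. *)
Lemma equiv_point_transfer : grmod_equiv w w' ->
  exists2 A : 'M[k]_n, A \in unitmx &
  forall (p : 'I_n -> nat) (q : 'I_n -> k), (exists j, q j != 0) ->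
  (forall i j, (p i)%:R * q j = w i j * ((p j)%:R * q i)) ->
  exists2 q' : 'I_n -> k, exists j, q' j != 0 &
  let p' i := \sum_j A i j * (p j)%:R in
  forall i j, p' i * q' j = w' i j * (p' j * q' i).
Proof.
case=> F [G [[eta] [eps]]].
have [e iso0] := F_fm hw hw' eta eps 0.
have iso1 := F_fm_succ eta eps o iso0; have iso2 := F_fm_succ eta eps o iso1.
have [a0 [b0 [ba0 ab0]]] := iso0; have [a1 [b1 [ba1 ab1]]] := iso1.
have [a2 [b2 [ba2 ab2]]] := iso2.
have [A Au AE] := transfer_matrix eta eps ba0 ab0 ba1 ab1.
have [B Bu BE] := transfer_matrix eta eps ba1 ab1 ba2 ab2.
(* [A] expands images of the old variables in the new ones, so the coordinates of a point change by
   the inverse. *)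
exists (invmx A); first by rewrite unitmx_inv.
move=> p q [j0 qj0] pq; pose N := pt pq.
pose u0 := fm_map hw (1 : gm_sp N 0); pose u1 := fm_map hw (1 : gm_sp N (0 + 1)).
pose u2 := fm_map hw (1 : gm_sp N (0 + 1 + 1)).
pose t0 := gh_fun (F_hom F u0) e (gh_fun a0 e (fm_gen hw' e)).
pose t1 := gh_fun (F_hom F u1) (e + 1) (gh_fun a1 (e + 1) (fm_gen hw' (e + 1))).
pose t2 := gh_fun (F_hom F u2) (e + 1 + 1) (gh_fun a2 (e + 1 + 1) (fm_gen hw' (e + 1 + 1))).
have h01 i : hcomp u0 (xhom hw 0 i) = hscale (p i)%:R u1.
  apply: fm_ext; rewrite hcompE /xhom fm_map_gen /fm_x gh_comm fm_map_gen.
  by rewrite hscaleE fm_map_gen /= /pt_act /pt_coef eqxx.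
have h12 i : hcomp u1 (xhom hw (0 + 1) i) = hscale (q i) u2.
  apply: fm_ext; rewrite hcompE /xhom fm_map_gen /fm_x gh_comm fm_map_gen.
  by rewrite hscaleE fm_map_gen /= /pt_act /pt_coef eqxx.
have act0 i : \sum_j A i j *: gm_act (F_obj F N) e j t0 = (p i)%:R *: t1.
  apply: (transfer_action AE _ (h01 i)).
  by rewrite (F_hscale_nat eta eps) F_hom_id.
(* The [s i] are what F makes of the scalars [q i]; only their nonvanishing is retained. *)
have /fin_all_exists2[s s0 sE] : forall i, exists2 s : k, (q i != 0 -> s != 0) &
    \sum_j B i j *: gm_act (F_obj F N) (e + 1) j t1 = s *: t2.
  move=> i; have [s s0 sE] := F_scalar eta eps ab2 (q i); exists s => //.
  exact: (transfer_action BE sE (h12 i)).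
have t20 : t2 != 0.
  apply/eqP => t20.
  have u20 : u2 <> hzero _ _.
    move/(hom_app (fm_gen hw (0 + 1 + 1))); rewrite fm_map_gen => /eqP.
    by rewrite (oner_eq0 k).
  apply: (F_neq0 eta eps u20); rewrite -[F_hom F u2]hcompf1 -ab2 hcompA.
  rewrite -(hzero_hcomp (F_obj F N) b2); congr (hcomp _ b2).
  by apply: fm_ext; rewrite hcompE.
have invert (V : lmodType k) (C : 'M[k]_n) (x y : 'I_n -> V) : C \in unitmx ->
    (forall i, \sum_j C i j *: x j = y i) -> forall i, x i = \sum_j invmx C i j *: y j.
  move=> Cu Cx i; under eq_bigr do rewrite -Cx scaler_sumr.
  rewrite exchange_big /=; transitivity (\sum_j (1%:M : 'M[k]_n) i j *: x j).
    rewrite (bigD1 i) //= mxE eqxx scale1r big1 ?addr0 // => j ji.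
    by rewrite mxE eq_sym (negbTE ji) scale0r.
  apply: eq_bigr => j _; rewrite -(mulVmx Cu) mxE scaler_suml.
  by apply: eq_bigr => l _; rewrite scalerA.
pose p' i := \sum_j invmx A i j * (p j)%:R; pose q' i := \sum_j invmx B i j * s j.
have x0 i : gm_act (F_obj F N) e i t0 = p' i *: t1.
  rewrite (invert _ _ _ _ Au act0) /p' scaler_suml.
  by apply: eq_bigr => j _; rewrite scalerA.
have x1 i : gm_act (F_obj F N) (e + 1) i t1 = q' i *: t2.
  rewrite (invert _ _ _ _ Bu sE) /q' scaler_suml.
  by apply: eq_bigr => j _; rewrite scalerA.
(* If [q'] vanished, row [j0] of [B] would give [s j0 *: t2 = 0], although [s j0] and [t2] are
   nonzero. *)
exists q'.
  apply: NNPP => q'0; have := s0 _ qj0; have := sE j0; rewrite big1 => [/esym/eqP|j _].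
    by rewrite scaler_eq0 (negbTE t20) orbF => ->.
  rewrite x1; have [->|qj] := eqVneq (q' j) 0; first by rewrite scale0r scaler0.
  by case: q'0; exists j.
move=> p'' i j; change (p' i * q' j = w' i j * (p' j * q' i)).
have := gm_rel i j t0; rewrite !x0 !actZ !x1 !scalerA => /eqP.
by rewrite -subr_eq0 -scalerBl scaler_eq0 (negbTE t20) orbF subr_eq0 -mulrA => /eqP.
Qed.
End PointTransfer.

(** * From points to faces *)

Section Faces.
Variables (k : fieldType) (n : nat) (w w' : 'M[k]_n).
Hypotheses (hchar : [pchar k] =i pred0).
Hypotheses (hw : cube_skew w) (hw' : cube_skew w').

(** In characteristic 0 the natural numbers stay distinct in k, and a nonzero polynomial has
    finitely many roots. *)
Lemma natr_nonroot (f : {poly k}) : f != 0 -> exists t : nat, f.[t%:R] != 0.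
Proof.
move=> f0; apply: NNPP => H.
have inj : injective (fun t : nat => t%:R : k).
  move=> a b; wlog ab : a b / (a <= b)%N => [hwlog|/eqP].
    by case: (leqP a b) => [/hwlog//|/ltnW/hwlog h /esym/h].
  rewrite eq_sym -subr_eq0 -natrB // (proj1 (pcharf0P k) hchar) subn_eq0 => ba.
  by apply/eqP; rewrite eqn_leq ab.
have := max_poly_roots f0 (rs := [seq t%:R | t <- iota 0 (size f)]).
rewrite size_map size_iota ltnn map_inj_uniq // iota_uniq => H'.
suff : false by []; apply: H' => //; apply/allP => _ /mapP[t _ ->].
by apply/negPn/negP => ft; apply: H; exists t.
Qed.

Lemma det_neq0_perm (A : 'M[k]_n) : A \in unitmx -> exists s : {perm 'I_n}, forall i, A i (s i) != 0.
Proof.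
rewrite unitmxE unitfE => dA; apply: NNPP => H; case/eqP: dA; apply: big1 => s _.
have [i Ai] : exists i, A i (s i) = 0.
  apply: NNPP => H'; apply: H; exists s => i; apply/eqP => Ai.
  by apply: H'; exists i.
by rewrite (bigD1 i) //= Ai mul0r mulr0.
Qed.

Lemma face_transfer (A : 'M[k]_n) (s : {perm 'I_n}) (F : {set 'I_n}) :
  (forall i, A (s i) i != 0) ->
  (forall (p : 'I_n -> nat) (q : 'I_n -> k), (exists j, q j != 0) ->
    (forall i j, (p i)%:R * q j = w i j * ((p j)%:R * q i)) ->
    exists2 q' : 'I_n -> k, exists j, q' j != 0 &
    let p' i := \sum_j A i j * (p j)%:R in
    forall i j, p' i * q' j = w' i j * (p' j * q' i)) ->
  pface w F -> pface w' (s @: F).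
Proof.
move=> As AE fF.
have [->|[h Fh]] := set_0Vmem F.
  by apply/(pfaceP hw') => i j l; rewrite imset0 inE.
(* For p_j = t^j on [F], [f i] is coordinate s(i) of A p as a polynomial in t. Its monomials are
   distinct, and for i in [F] one has the nonzero coefficient [A (s i) i]. *)
pose f (i : 'I_n) : {poly k} := \sum_(j in F) A (s i) j *: 'X^j.
have f0 i : i \in F -> f i != 0.
  move=> Fi; apply: contraNneq (As i) => /(congr1 (fun r : {poly k} => r`_i)).
  rewrite coef0 coef_sum (bigD1 i) //= coefZ coefXn eqxx mulr1 big1 ?addr0 => [->//|j /andP[_ ji]].
  by rewrite coefZ coefXn eq_sym (inj_eq val_inj) (negbTE ji) mulr0.
(* The factor X keeps t, hence every p_j on [F], away from 0. *)
have [|t] := natr_nonroot (f := 'X * \prod_(i in F) f i).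
  by rewrite mulf_neq0 ?polyX_eq0 //; apply/prodf_neq0.
rewrite hornerM hornerX horner_prod mulf_eq0 negb_or => /andP[t0 /prodf_neq0 ft].
pose p (j : 'I_n) : nat := (if j \in F then t ^ j else 0)%N.
have pF j : j \notin F -> p j = 0%N by rewrite /p => /negbTE->.
(* A successor of [p] on the face: the triangles h, i, j give w_hj = w_hi w_ij. *)
pose q j : k := w h j * (p j)%:R.
have [||q' [j0 qj0] pq'] := AE p q.
- exists h; rewrite /q /p Fh mulf_neq0 ?(cube_skew_neq0 hw) //.
  by rewrite natrX expf_neq0.
- move=> i j; rewrite /q; have [Fi|Fi] := boolP (i \in F); last first.
    by rewrite (pF _ Fi) !(mulr0n, mul0r, mulr0).
  have [Fj|Fj] := boolP (j \in F); last first.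
    by rewrite (pF _ Fj) !(mulr0n, mul0r, mulr0).
  have := pfaceP hw F fF _ _ _ Fh Fi Fj; rewrite /tc.
  have [_ hV _] := hw => e.
  have -> : w h j = w h i * w i j.
    by rewrite -[RHS]mulr1 -(hV j h) mulrA e mul1r.
  by ring.
set p' := fun i => _ in pq'.
have p'0 i : i \in F -> p' (s i) != 0.
  move=> Fi; suff -> : p' (s i) = (f i).[t%:R] by apply: ft.
  rewrite /f horner_sum /p' [LHS](bigID (mem F)) /=.
  rewrite [X in _ + X]big1 ?addr0 => [|j Fj]; last by rewrite pF // mulr0.
  by apply: eq_bigr => j Fj; rewrite hornerZ hornerXn /p Fj natrX.
(* Otherwise the relation between s(i) and [j0] would equate a nonzero side with zero. *)
have q'0 i : i \in F -> q' (s i) != 0.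
  move=> Fi; apply: contraNneq qj0 => qi.
  have /eqP := pq' (s i) j0; rewrite qi !mulr0 mulf_eq0 (negbTE (p'0 _ Fi)).
  by [].
apply/(pfaceP hw') => _ _ _ /imsetP[i Fi ->] /imsetP[j Fj ->] /imsetP[l Fl ->].
have e1 := pq' (s i) (s j); have e2 := pq' (s j) (s l); have e3 := pq' (s l) (s i).
(* Multiplying the three relations around the triangle gives c P = P with P nonzero. *)
pose P := p' (s i) * p' (s j) * p' (s l) * (q' (s i) * q' (s j) * q' (s l)).
have P0 : P != 0 by rewrite !mulf_neq0 ?p'0 ?q'0.
apply: (mulIf P0); rewrite mul1r /tc.
transitivity ((w' (s i) (s j) * (p' (s j) * q' (s i))) * (w' (s j) (s l) * (p' (s l) * q' (s j)))
   * (w' (s l) (s i) * (p' (s i) * q' (s l)))); first by rewrite /P; ring.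
by rewrite -e1 -e2 -e3 /P; ring.
Qed.
End Faces.

Lemma equiv_face_perm (k : fieldType) (hchar : [pchar k] =i pred0) (n : nat) (w w' : 'M[k]_n)
    (hw : cube_skew w) (hw' : cube_skew w') (o : 'I_n) : grmod_equiv w w' ->
  exists s : {perm 'I_n}, forall F : {set 'I_n}, pface w F -> pface w' (s @: F).
Proof.
move=> /(equiv_point_transfer hw hw' o)[A Au AE].
have [s sA] : exists s : {perm 'I_n}, forall i, A (s i) i != 0.
  rewrite -unitmx_tr in Au; have [s sA] := det_neq0_perm Au.
  by exists s => i; have := sA i; rewrite mxE.
by exists s => F; apply: (face_transfer hchar hw hw' sA AE).
Qed.

Lemma equiv_sc_iso (k : fieldType) (hchar : [pchar k] =i pred0) (n : nat) (w w' : 'M[k]_n)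
    (hw : cube_skew w) (hw' : cube_skew w') : grmod_equiv w w' -> sc_iso w w'.
Proof.
move=> weq; case: (pickP (fun _ : 'I_n => true)) => [o _|n0]; last first.
  exists 1%g => F; suff -> : w = w' by congr (pfacet _ _); apply/setP => i; have := n0 i.
  by apply/matrixP => i; have := n0 i.
have [s sE] := equiv_face_perm hchar hw hw' o weq.
have [s' sE'] : exists s : {perm 'I_n}, forall F : {set 'I_n}, pface w' F -> pface w (s @: F).
  apply: (equiv_face_perm hchar hw' hw o).
  by case: weq => F [G [? ?]]; exists G, F.
have inj (t : {perm 'I_n}) : injective (fun F : {set 'I_n} => t @: F).
  exact: imset_inj (@perm_inj _ t).
pose D := [set F | pface w F]; pose D' := [set F | pface w' F].
have sub : [set s @: F | F : {set 'I_n} in D] \subset D'.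
  by apply/subsetP => _ /imsetP[F + ->]; rewrite !inE => /sE.
(* Injections in both directions between the finite sets of faces make the inclusion an equality. *)
have eqD : [set s @: F | F : {set 'I_n} in D] = D'.
  apply/eqP; rewrite eqEcard sub card_imset //= -(card_imset (mem D') (inj s')).
  by apply/subset_leq_card/subsetP => _ /imsetP[F + ->]; rewrite !inE => /sE'.
have faceE F : pface w F = pface w' (s @: F).
  by have := mem_imset D F (inj s); rewrite eqD !inE => ->.
(* A bijection of faces induced by [s] respects inclusion, so it matches the maximal faces. *)
exists s => F; rewrite /pfacet faceE; congr (_ && _).
apply/forallP/forallP => H K.
  have KE : s @: (s @^-1: K) = K by rewrite -preim_permV; apply/setP => x; rewrite !inE permKV.
  apply/implyP => /andP[fK sFK]; rewrite -KE (inj_eq (inj s)).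
  apply: (implyP (H _)); rewrite faceE KE fK /=.
  by apply/subsetP => x xF; rewrite inE (subsetP sFK) // imset_f.
apply/implyP => /andP[fK sFK]; rewrite -(inj_eq (inj s)).
by apply: (implyP (H _)); rewrite -faceE fK imsetS.
Qed.

Theorem theorem5p2 (k : closedFieldType) (hchar : [pchar k] =i pred0)
  (n : nat) (hn : (n <= 5)%N) (w w' : 'M[k]_n)
  (hw : cube_skew w) (hw' : cube_skew w') :
  grmod_equiv w w' <-> sc_iso w w'.
Proof. by split; [exact: equiv_sc_iso | exact: sc_iso_equiv]. Qed.
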